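(* Consider the $\ell_1$ tolerant testing problem $H_0:\|v\|_1\le\epsilon_0$ versus $H_1:\|v\|_1\ge\epsilon_1$ in the Gaussian sequence model. Given $\epsilon_0\ge 0$, let $\lambda=\epsilon_0/\sigma$. Then, up to logarithmic factors in $d$, the critical separation satisfies $$\epsilon_1^*(\epsilon_0,\mathrm{GS})-\epsilon_0\asymp \sigma\cdot\begin{cases} d^{3/4}, & \text{if } 0\le\lambda\lesssim\sqrt d,\\ d^{1/2}\cdot\lambda^{1/2}, & \text{if } d^{1/2}\lesssim\lambda\lesssim d,\\ d, & \text{if }\lambda\asymp d.\end{cases}$$ Furthermore, the plug-in test $\psi_1$ attains this critical separation: $\psi_1$ is valid, and (up to the same logarithmic factors and constants) it is powerful as soon as $\epsilon_1-\epsilon_0$ exceeds the rate on the right-hand side.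
   Context: Model. Fix $\alpha\in(0,1)$ and $\beta\in(0,1-\alpha)$. For an integer $d\ge1$, $\sigma\in(0,1]$ and $v\in\mathbb{R}^d$ let $P_v=\mathcal N(v,\sigma^2 I_d)$, and let $\mathrm{GS}=\{P_v:v\in\mathbb{R}^d\}$. One observes a single $X\sim P_v$. For $0\le\epsilon_0\le\epsilon_1$, a test is a measurable map $\psi:\mathbb{R}^d\to\{0,1\}$ (value $1$ means rejecting $H_0$). It is valid if $\sup_{\|v\|_1\le\epsilon_0}P_v(\psi(X)=1)\le\alpha$, and powerful if $\sup_{\|v\|_1\ge\epsilon_1}P_v(\psi(X)=0)\le\beta$. The minimax risk $R_*(\epsilon_0,\epsilon_1,\mathrm{GS})$ is the infimum over valid tests $\psi$ of $\sup_{\|v\|_1\ge\epsilon_1}P_v(\psi(X)=0)$. Define $\epsilon_1^*(\epsilon_0,\mathrm{GS})=\inf\{\epsilon_1\ge\epsilon_0: R_*(\epsilon_0,\epsilon_1,\mathrm{GS})<\beta\}$; the critical separation is $\epsilon_1^*(\epsilon_0,\mathrm{GS})-\epsilon_0$. Plug-in test. $T_1(X)=\|X\|_1-E_{P_0}\|X\|_1$ and $\psi_1(X,\epsilon_0)=I\big(T_1(X)\ge\sup_{\|v\|_1\le\epsilon_0}q_{1-\alpha}(T_1,P_v)\big)$, where $q_{1-\alpha}(T,P_v)$ is the $1-\alpha$ quantile of $T(X)$ when $X\sim P_v$. Conventions. The symbols $\lesssim,\asymp$ in the regime conditions on $\lambda$ involve arbitrary but fixed positive constants. ''Up to logarithmic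 factors'' means: writing $r$ for the displayed right-hand side (including the factor $\sigma$), there are positive constants $c,C,a$, depending only on $\alpha,\beta$ and the constants in the regime conditions, such that $c(\log d)^{-a}r\le\epsilon_1^*(\epsilon_0,\mathrm{GS})-\epsilon_0\le C(\log d)^{a}r$ for all sufficiently large $d$. *)

(* Defs.v *)
From HB Require Import structures.
From mathcomp Require Import all_boot all_order all_algebra.
From mathcomp Require Import all_classical all_reals all_analysis.

Set Implicit Arguments.
Unset Strict Implicit.
Unset Printing Implicit Defensive.

Import Order.TTheory GRing.Theory Num.Theory.
Import numFieldNormedType.Exports.

Local Open Scope classical_set_scope.
Local Open Scope ring_scope.

(** Points of R^d are [d.-tuple R], which the library equips with the
    sigma-algebra generated by the coordinate maps, i.e. the Borel one. *)

Section product_probability.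
Context {R : realType}.

Definition tcons n (x : R * n.-tuple R) : n.+1.-tuple R :=
  [tuple of x.1 :: x.2].

Let measurable_tcons n : measurable_fun setT (@tcons n).
Proof. exact: (measurable_cons measurable_fst measurable_snd). Qed.

HB.instance Definition _ n :=
  isMeasurableFun.Build _ _ _ _ (@tcons n) (@measurable_tcons n).

Fixpoint prod_prob n : ('I_n -> probability R R) ->
    probability (n.-tuple R) R :=
  match n with
  | 0 => fun=> dirac [tuple]
  | m.+1 => fun P =>
      distribution (P ord0 \x prod_prob (P \o lift ord0))%E (@tcons m)
  end.

Let measurable_box n (A : 'I_n -> set R) : (forall i, measurable (A i)) ->
  measurable [set x : n.-tuple R | forall i, A i (tnth x i)].
Proof.
move=> mA; rewrite (_ : [set _ | _] = \bigcap_(i in [set: 'I_n])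
    (setT `&` (@tnth n R)^~ i @^-1` A i)); last first.
  by apply/seteqP; split => x /= xA i *; [split|have [] := xA i I].
apply: (@fin_bigcap_measurable _ (n.-tuple R)) => [|i _].
  exact: finite_finset.
exact: (@measurable_tnth _ _ n i measurableT _ (mA i)).
Qed.

(* The defining property of the product measure. *)
Lemma prod_probE n (P : 'I_n -> probability R R) (A : 'I_n -> set R) :
  (forall i, measurable (A i)) ->
  prod_prob P [set x | forall i, A i (tnth x i)] = (\prod_(i < n) P i (A i))%E.
Proof.
elim: n P A => [|n IHn] P A mA /=.
  by rewrite big_ord0 diracE mem_set// => -[].
rewrite big_ord_recl /distribution /pushforward /=.
rewrite (_ : _ @^-1` _ = A ord0 `*`
    [set x : n.-tuple R | forall i, A (lift ord0 i) (tnth x i)]).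
  rewrite [LHS]product_measure1E //; last first.
    exact: (@measurable_box n (fun i => A (lift ord0 i))).
  congr (_ * _)%E.
  exact: (IHn (P \o lift ord0) (fun i => A (lift ord0 i))).
apply/seteqP; split => -[x y] /=.
  move=> xyA; split => [|i]; first exact: (xyA ord0).
  by have := xyA (lift ord0 i); rewrite tnthS.
move=> [x0 yA] i; case: (unliftP ord0 i) => [j|] -> //.
by rewrite tnthS; exact: yA.
Qed.

End product_probability.

Section borel_id.
Context {R : realType}.

Definition borel_id (x : measurableTypeR R) : R := x.

Let measurable_borel_id : measurable_fun setT borel_id.
Proof. by move=> _ A mA; rewrite setTI. Qed.

HB.instance Definition _ :=
  isMeasurableFun.Build _ _ _ _ borel_id measurable_borel_id.

End borel_id.

Section tolerant_testing.
Context {R : realType}.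
Variable d : nat.
Implicit Types (v x : d.-tuple R) (psi : d.-tuple R -> bool).

Definition l1norm v : R := \sum_(i < d) `|tnth v i|.

Variable sigma : R.

(* N(v, sigma^2 I_d); the second argument of [normal_prob] is the standard
   deviation. [borel_id] only changes the measurable structure on R from that
   of [measurableTypeR R], where [normal_prob] lives, to the default one, with
   the same measurable sets. *)
Definition gauss v : probability (d.-tuple R) R :=
  prod_prob (fun i => distribution (normal_prob (tnth v i) sigma) borel_id).

Lemma gaussE v (A : 'I_d -> set R) : (forall i, measurable (A i)) ->
  gauss v [set x | forall i, A i (tnth x i)] =
  (\prod_(i < d) normal_prob (tnth v i) sigma (A i))%E.
Proof. exact: prod_probE. Qed.

Definition null_hyp (eps0 : R) : set (d.-tuple R) := [set v | l1norm v <= eps0].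
Definition alt_hyp (eps1 : R) : set (d.-tuple R) := [set v | eps1 <= l1norm v].

Definition type1_risk (eps0 : R) psi : \bar R :=
  ereal_sup [set gauss v [set x | psi x = true] | v in null_hyp eps0].

Definition type2_risk (eps1 : R) psi : \bar R :=
  ereal_sup [set gauss v [set x | psi x = false] | v in alt_hyp eps1].

Definition valid (alpha eps0 : R) psi : Prop :=
  measurable_fun setT psi /\ (type1_risk eps0 psi <= alpha%:E)%E.

Definition powerful (beta eps1 : R) psi : Prop :=
  measurable_fun setT psi /\ (type2_risk eps1 psi <= beta%:E)%E.

Definition minimax_risk (alpha eps0 eps1 : R) : \bar R :=
  ereal_inf [set type2_risk eps1 psi | psi in valid alpha eps0].

(* [+oo] if no [eps1] qualifies. *)
Definition eps1_star (alpha beta eps0 : R) : \bar R :=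
  ereal_inf [set eps1%:E | eps1 in
    [set eps1 | eps0 <= eps1 /\ (minimax_risk alpha eps0 eps1 < beta%:E)%E]].

Definition critical_separation (alpha beta eps0 : R) : \bar R :=
  (eps1_star alpha beta eps0 - eps0%:E)%E.

Definition quantile (p : R) (T : d.-tuple R -> R)
    (P : probability (d.-tuple R) R) : \bar R :=
  ereal_inf [set t%:E | t in [set t | (p%:E <= P [set x | (T x <= t)%R])%E]].

Definition plugin_stat x : R :=
  l1norm x - fine 'E_(gauss [tuple 0 | _ < d])[l1norm].

Definition plugin_test (alpha eps0 : R) x : bool :=
  (ereal_sup [set quantile (1 - alpha) plugin_stat (gauss v) |
              v in null_hyp eps0]
   <= (plugin_stat x)%:E)%E.

End tolerant_testing.

(* [r] is the claimed rate, [sigma] included, in one of the three regimes of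
   [lambda]; [K1], [k2], [K2], [k3], [K3] are the constants hidden in them.
   The regimes may overlap. *)
Definition regime_rate {R : realType} (K1 k2 K2 k3 K3 : R)
    (d : nat) (sigma lambda r : R) : Prop :=
  [\/ 0 <= lambda <= K1 * Num.sqrt d%:R /\ r = sigma * d%:R `^ (3 / 4),
      k2 * Num.sqrt d%:R <= lambda <= K2 * d%:R /\
        r = sigma * (Num.sqrt d%:R * Num.sqrt lambda)
    | k3 * d%:R <= lambda <= K3 * d%:R /\ r = sigma * d%:R].

(* Main.v *)
Require Import Defs.
From HB Require Import structures.
From mathcomp Require Import all_boot all_order all_algebra.
From mathcomp Require Import all_classical all_reals all_analysis.
From mathcomp Require Import measurable_realfun zify ring lra.

(** The test statistic is a sum of independent terms |X_i|, each with variance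
    at most a constant times sigma^2 whatever its mean, so by Chebyshev's
    inequality it deviates from its expectation by O(sigma sqrt d)
    ([variance_l1norm], [l1norm_chebyshev]). The analysis of the plug-in test
    thus reduces to that of the mean excess S(v) = sum_i (E_v|X_i| - E_0|X_i|).
    Always S(v) <= |v|_1, so that the threshold is at most
    eps0 + O(sigma sqrt d). In the other direction, E_v|X_i| - E_0|X_i| is the
    expectation of (|v_i| - |Z|)_+ for a centred Z: it behaves like the Huber
    function, quadratic up to sigma and linear with a deficit O(sigma) beyond.
    In units of sigma, an alternative of l1 norm x therefore has S at least of
    order x^2 / d when x <= d, and at least x - O(d) always. Comparing with the
    threshold lambda + O(sqrt d) shows that a separation of order
    sqrt (d lambda) + d^(3/4) suffices ([excess_gap], [plugin_type2_rate]).
    Validity is exact, because the law of the l1 norm has no atom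
    ([quantile_level], [gauss_l1norm_atom]).

    For the lower bounds, a null and an alternative prior with independent
    coordinates are put on v. Their l1 norms concentrate around different
    values, but no test can tell the two Gaussian mixtures apart as soon as the
    chi-square divergence per coordinate is a small multiple of 1 / d
    ([mixture_second_moment], [mixture_chi2_le], [minimax_risk_ge]). This
    divergence is controlled by the moments on which the priors differ.
    - Dense: the origin and the random signs +-tau have the same mean, the
      divergence is of order (tau / sigma)^4, and tau of order
      sigma d^(-1/4) gives the separation sigma d^(3/4)
      ([minimax_risk_dense_rate]).
    - Sparse: two priors agreeing on their first 2N+1 moments, with N of order
      log d, have divergence exponentially small in N. Finite differences on
      -N, ..., N with two extra nodes +-h give such a pair in which the null
      prior has first absolute moment O(h^2), up to powers of N, and the
      alternative stays at distance at least h from the origin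
      ([moment_matching_priors]). The null budget lambda then allows h of order
      sqrt (lambda / d), again up to powers of N, whence the separation sigma sqrt (d lambda) / (log d)^2
      ([minimax_risk_sparse_rate]).

    In each of the three regimes the claimed rate is comparable with the larger
    of these two rates ([regime_rate_bounds]). Logarithms are lost in the
    sparse lower bound only. *)

Set Implicit Arguments.
Unset Strict Implicit.
Unset Printing Implicit Defensive.
Import Order.TTheory GRing.Theory Num.Theory.
Import numFieldNormedType.Exports.

Local Open Scope classical_set_scope.
Local Open Scope ring_scope.

(** * Gaussian vectors, one coordinate at a time *)

Section normal1.
Context {R : realType}.
Variable sigma : R.
Local Notation mu := (@lebesgue_measure R).

Definition coord_law (v : R) : probability R R :=
  distribution (normal_prob v sigma) borel_id.

Lemma ge0_integral_coord_law v (f : R -> \bar R) :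
  measurable_fun setT f -> (forall x, 0 <= f x)%E ->
  (\int[coord_law v]_x f x = \int[mu]_x (f x * (normal_pdf v sigma x)%:E))%E.
Proof.
move=> mf f0; rewrite ge0_integral_distribution//.
rewrite -(@Radon_Nikodym_SigmaFinite.change_of_variables _ _ _ _ mu
  (normal_prob_dominates v sigma))//.
apply: ae_eq_integral => //.
- apply: emeasurable_funM => //.
  exact: measurable_int (Radon_Nikodym_SigmaFinite.f_integrable (normal_prob_dominates v sigma)).
- apply: emeasurable_funM => //; apply/measurable_EFinP.
  exact: measurable_normal_pdf.
apply: ae_eqe_mul2l.
apply: integral_ae_eq => //.
- exact: Radon_Nikodym_SigmaFinite.f_integrable (normal_prob_dominates v sigma).
- apply/measurable_EFinP; exact: measurable_normal_pdf.
- move=> E _ mE.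
  by rewrite -(Radon_Nikodym_SigmaFinite.f_integral (normal_prob_dominates v sigma)).
Qed.

End normal1.

Section product.
Context {R : realType}.
Variable sigma : R.
Local Notation mu := (@lebesgue_measure R).
Local Notation gauss := (@gauss R _ sigma).

Lemma gauss_tcons n (b : R) (v : n.-tuple R) :
  gauss (tcons (b, v)) =
  distribution (coord_law sigma b \x gauss v)%E (@tcons R n).
Proof.
rewrite /Defs.gauss.
pose law (u : R) : probability R R :=
  distribution (normal_prob u sigma) borel_id.
pose P := fun i : 'I_n.+1 => law (tnth (tcons (b, v)) i).
have PE : P \o lift ord0 = (fun i : 'I_n => law (tnth v i)).
  by apply/funext => i; rewrite /P /tcons /= tnthS.
change (prod_prob P = distribution
  (law b \x prod_prob (fun i => law (tnth v i)))%E (@tcons R n)).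
by rewrite -PE.
Qed.

Lemma measurable_tcons n : measurable_fun setT (@tcons R n).
Proof. exact: (measurable_cons measurable_fst measurable_snd). Qed.

(** Conditioning on the first coordinate, the step of all inductions on the
    dimension below. *)
Lemma integral_gauss_tcons n b (v : n.-tuple R) (f : n.+1.-tuple R -> \bar R) :
  measurable_fun setT f -> (forall x, 0 <= f x)%E ->
  (\int[gauss (tcons (b, v))]_x f x =
   \int[coord_law sigma b]_x \int[gauss v]_y f (tcons (x, y)))%E.
Proof.
move=> mf f0; rewrite gauss_tcons ge0_integral_distribution//.
rewrite -(fubini_tonelli1 (fun z => f (tcons z)))//.
by apply: measurableT_comp => //; exact: measurable_tcons.
Qed.

Lemma measurable_integral_tcons n (v : n.-tuple R) (f : n.+1.-tuple R -> \bar R) :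
  measurable_fun setT f -> (forall x, 0 <= f x)%E ->
  measurable_fun setT (fun x => \int[gauss v]_y f (tcons (x, y)))%E.
Proof.
move=> mf f0.
apply: (measurable_fun_fubini_tonelli_F (fun z => f (tcons z))) => //.
by apply: measurableT_comp => //; exact: measurable_tcons.
Qed.

Lemma measurable_section n x (f : n.+1.-tuple R -> \bar R) :
  measurable_fun setT f -> measurable_fun setT (fun y => f (tcons (x, y))).
Proof.
move=> mf; apply: (measurableT_comp mf).
by apply: (measurable_cons (f := cst x) (g := id)).
Qed.

End product.

(** * Product priors with finitely many atoms *)

Section mix.
Context {R : realType} {I : finType}.
Variable a : I -> R.
Implicit Types p : I -> R.

(** Expectation of [F v] when the coordinates of [v] are independent and equal
    to [a i] with probability [p i]. A finite nested sum, rather than a measure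
    on vectors, makes exchanges with integrals independent of any
    measurability in [v]. *)
Fixpoint mix p n : (n.-tuple R -> \bar R) -> \bar R :=
  match n with
  | 0 => fun F => F [tuple]
  | m.+1 => fun F => (\sum_i (p i)%:E * mix p (fun v => F (tcons (a i, v))))%E
  end.

Definition prior p := (forall i, 0 <= p i) /\ \sum_i p i = 1.

Lemma mix_ge0 p n (F : n.-tuple R -> \bar R) : (forall i, 0 <= p i) ->
  (forall v, 0 <= F v)%E -> (0 <= mix p F)%E.
Proof.
move=> p0; elim: n F => //= n IH F F0.
by apply: sume_ge0 => i _; rewrite mule_ge0 ?lee_fin ?IH.
Qed.

Lemma eq_mix p n (F G : n.-tuple R -> \bar R) : F =1 G -> mix p F = mix p G.
Proof. by move=> FG; congr mix; exact/funext. Qed.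

(** Only the vectors charged by the prior matter: the alternative prior lies in
    the alternative hypothesis through the support of its weights, not through
    all the atoms. *)
Lemma le_mix p (S : set R) n (F G : n.-tuple R -> \bar R) :
  (forall i, 0 <= p i) -> (forall i, p i != 0 -> S (a i)) ->
  (forall v, (forall i, S (tnth v i)) -> F v <= G v)%E ->
  (mix p F <= mix p G)%E.
Proof.
move=> p0 pS; elim: n F G => [|n IH] F G FG /=; first by apply: FG => -[].
apply: lee_sum => i _; have [->|pi0] := eqVneq (p i) 0; first by rewrite !mul0e.
rewrite lee_pmul2l// ?lte_fin ?lt_def ?pi0 ?p0//.
apply: IH => v Sv; apply: FG => j.
by case: (unliftP ord0 j) => [k|] ->; rewrite /tcons /= ?tnthS//; exact: pS.
Qed.

Lemma le_mixT p n (F G : n.-tuple R -> \bar R) :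
  (forall i, 0 <= p i) -> (forall v, F v <= G v)%E -> (mix p F <= mix p G)%E.
Proof. by move=> p0 FG; apply: (@le_mix _ setT). Qed.

Lemma mixD p n (F G : n.-tuple R -> \bar R) : (forall i, 0 <= p i) ->
  (forall v, 0 <= F v)%E -> (forall v, 0 <= G v)%E ->
  mix p (fun v => F v + G v)%E = (mix p F + mix p G)%E.
Proof.
move=> p0; elim: n F G => //= n IH F G F0 G0.
rewrite -big_split/=; apply: eq_bigr => i _.
by rewrite IH// ge0_muleDr// mix_ge0.
Qed.

Lemma mixZl p n (c : R) (F : n.-tuple R -> \bar R) : (forall i, 0 <= p i) ->
  (forall v, 0 <= F v)%E ->
  mix p (fun v => c%:E * F v)%E = (c%:E * mix p F)%E.
Proof.
move=> p0; elim: n F => //= n IH F F0.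
rewrite ge0_sume_distrr; last by move=> i _; rewrite mule_ge0 ?lee_fin ?mix_ge0.
by apply: eq_bigr => i _; rewrite IH// muleCA.
Qed.

Lemma mix_cst p n (c : R) : \sum_i p i = 1 ->
  mix p (fun _ : n.-tuple R => c%:E) = c%:E.
Proof.
move=> p1; elim: n => //= n IH; rewrite IH.
under eq_bigr do rewrite -EFinM.
by rewrite sumEFin -mulr_suml p1 mul1r.
Qed.

Lemma mix_l1norm p n : prior p ->
  mix p (fun v : n.-tuple R => (l1norm v)%:E) = (n%:R * \sum_i p i * `|a i|)%:E.
Proof.
move=> [p0 p1]; elim: n => [|n IH] /=.
  by rewrite /l1norm big_ord0 mul0r.
under eq_bigr => i _.
  rewrite (@eq_mix _ _ _ (fun v => (`|a i|)%:E + (l1norm v)%:E)%E); last first.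
    move=> v; rewrite -EFinD /l1norm big_ord_recl; congr (_ + _)%:E.
    by apply: eq_bigr => j _; rewrite /tcons /= tnthS.
  rewrite mixD//; last by move=> v; rewrite lee_fin sumr_ge0.
  rewrite mix_cst// IH -EFinD -EFinM mulrDr.
  over.
by rewrite sumEFin big_split/= -mulr_suml p1 mul1r -natr1 mulrDl mul1r addrC.
Qed.

Context {d} {T : measurableType d}.
Variable m : {measure set T -> \bar R}.

Lemma measurable_mix p n (J : n.-tuple R -> T -> \bar R) :
  (forall i, 0 <= p i) ->
  (forall v, measurable_fun setT (J v)) ->
  measurable_fun setT (fun x => mix p (J^~ x)).
Proof.
move=> p0; elim: n J => //= n IH J mJ.
apply: emeasurable_sum => i _.
apply: measurable_funeM => //.
exact: (IH (fun v => J (tcons (a i, v)))).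
Qed.

Lemma mix_integral p n (J : n.-tuple R -> T -> \bar R) :
  (forall i, 0 <= p i) ->
  (forall v, measurable_fun setT (J v)) -> (forall v x, 0 <= J v x)%E ->
  mix p (fun v => \int[m]_x J v x)%E = (\int[m]_x mix p (J^~ x))%E.
Proof.
move=> p0; elim: n J => //= n IH J mJ J0.
rewrite ge0_integral_sum//.
- apply: eq_bigr => i _; rewrite IH// ge0_integralZl//.
  + exact: (measurable_mix (J := fun v => J (tcons (a i, v)))).
  + by move=> x _; exact: mix_ge0.
  + by rewrite lee_fin.
- move=> i; apply: measurable_funeM => //.
  exact: (measurable_mix (J := fun v => J (tcons (a i, v)))).
- by move=> i x _; rewrite mule_ge0 ?lee_fin// mix_ge0.
Qed.

End mix.

(** * Chi-square bounds for Gaussian mixtures *)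

Section tensor.
Context {R : realType} {I : finType}.
Variables (sigma : R) (a : I -> R).
Implicit Types p : I -> R.
Local Notation mu := (@lebesgue_measure R).
Local Notation gauss := (@gauss R _ sigma).
Local Notation mix := (mix a).

Definition mixture_pdf p (x : R) : R := \sum_i p i * normal_pdf (a i) sigma x.

Lemma measurable_mixture_pdf p : measurable_fun setT (mixture_pdf p).
Proof.
apply: measurable_sum => i; apply: measurable_funM => //.
exact: measurable_normal_pdf.
Qed.

Lemma mixture_pdf_ge0 p x : (forall i, 0 <= p i) -> 0 <= mixture_pdf p x.
Proof. by move=> p0; apply: sumr_ge0 => i _; rewrite mulr_ge0 ?normal_pdf_ge0. Qed.

Lemma measurable_chi2_density p0 p1 : (forall x, 0 < mixture_pdf p0 x) ->
  measurable_fun setT (fun x => (mixture_pdf p1 x ^+ 2 / mixture_pdf p0 x)%:E).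
Proof.
move=> f00; apply/measurable_EFinP; apply: measurable_funM.
  by apply: measurable_funX; exact: measurable_mixture_pdf.
rewrite (_ : (fun x => _^-1) = (fun x => mixture_pdf p0 x `^ (-1))).
  exact: (measurableT_comp (measurable_powR (-1)) (measurable_mixture_pdf p0)).
by apply/funext => x; rewrite powR_inv1// ltW.
Qed.

(** Integrating out the first coordinate turns its prior into a density with
    respect to Lebesgue measure. *)
Lemma mix_gaussS p n (f : n.+1.-tuple R -> \bar R) :
  (forall i, 0 <= p i) -> measurable_fun setT f -> (forall x, 0 <= f x)%E ->
  mix p (fun v => \int[gauss v]_x f x)%E =
  (\int[mu]_x (mix p (fun v => \int[gauss v]_y f (tcons (x, y)))
               * (mixture_pdf p x)%:E))%E.
Proof.
move=> p0 mf f0 /=.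
have J0 v x : (0 <= \int[gauss v]_y f (@tcons R n (x, y)))%E.
  exact: integral_ge0.
have mJ (v : n.-tuple R) := measurable_integral_tcons sigma v mf f0.
have mG : measurable_fun setT
    (fun x => mix p (fun v => \int[gauss v]_y f (@tcons R n (x, y))))%E.
  exact: (measurable_mix _ (J := fun v x => \int[gauss v]_y f (tcons (x, y))))%E.
have G0 x : (0 <= mix p (fun v => \int[gauss v]_y f (@tcons R n (x, y))))%E.
  exact: mix_ge0.
have mpdf b : measurable_fun setT (fun x => (normal_pdf b sigma x)%:E).
  by apply/measurable_EFinP; exact: measurable_normal_pdf.
have mGpdf b := emeasurable_funM mG (mpdf b).
transitivity (\sum_i \int[mu]_x ((p i)%:E *
   (mix p (fun v => \int[gauss v]_y f (@tcons R n (x, y)))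
    * (normal_pdf (a i) sigma x)%:E)))%E.
  apply: eq_bigr => i _.
  rewrite (eq_mix a p (fun v => integral_gauss_tcons sigma (a i) v mf f0)).
  rewrite mix_integral// ge0_integral_coord_law// ge0_integralZl//.
  - exact: mGpdf.
  - by move=> x _; rewrite mule_ge0 ?lee_fin ?normal_pdf_ge0.
  - by rewrite lee_fin.
rewrite -ge0_integral_sum//; last 2 first.
- by move=> i; apply: measurable_funeM => //; exact: mGpdf.
- by move=> i x _; rewrite !mule_ge0 ?lee_fin ?normal_pdf_ge0.
apply: eq_integral => x _.
rewrite /mixture_pdf -sumEFin ge0_sume_distrr; last first.
  by move=> i _; rewrite lee_fin mulr_ge0 ?normal_pdf_ge0.
by apply: eq_bigr => i _; rewrite EFinM muleCA.
Qed.

(** Tensorization of the chi-square divergence. The Cauchy-Schwarz inequality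
    (E_1 g)^2 <= K^n E_0 g^2 is stated in the linearized form
    2ab <= t a^2 + b^2 / t, which is stable by integration and therefore goes
    through an induction on the coordinates, [t] depending on the value of the
    first one. *)
Lemma mixture_second_moment p0 p1 K n (g : n.-tuple R -> R) t :
  (forall i, 0 <= p0 i) -> (forall i, 0 <= p1 i) ->
  (forall x, 0 < mixture_pdf p0 x) ->
  (\int[mu]_x (mixture_pdf p1 x ^+ 2 / mixture_pdf p0 x)%:E <= K%:E)%E ->
  measurable_fun setT g -> (forall x, 0 <= g x) -> 0 < t ->
  (2%:E * mix p1 (fun v => \int[gauss v]_x (g x)%:E) <=
   t%:E * mix p0 (fun v => \int[gauss v]_x (g x ^+ 2)%:E) + (K ^+ n / t)%:E)%E.
Proof.
move=> p00 p10 f00 HK.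
have K0 : 0 <= K.
  rewrite -lee_fin; apply: le_trans HK; apply: integral_ge0 => x _.
  by rewrite lee_fin divr_ge0 ?sqr_ge0 ?ltW.
elim: n g t => [|n IH] g t mg g0 t0.
  rewrite /= !integral_dirac//; last 2 first.
  - by apply/measurable_EFinP; apply: measurable_funX.
  - by apply/measurable_EFinP.
  rewrite !diracT !mul1e -!EFinM -EFinD lee_fin.
  rewrite -subr_ge0 expr0 (_ : _ - _ = (t * g [tuple] - 1) ^+ 2 / t).
    by rewrite divr_ge0 ?sqr_ge0 ?ltW.
  by field; rewrite gt_eqF.
have mg1 : measurable_fun setT (EFin \o g) by exact/measurable_EFinP.
have mg2 : measurable_fun setT (fun x => (g x ^+ 2)%:E).
  by apply/measurable_EFinP; apply: measurable_funX.
rewrite !mix_gaussS//; [|by move=> x; rewrite lee_fin ?sqr_ge0 ?g0..].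
pose G x := mix p1 (fun v => \int[gauss v]_y (g (@tcons R n (x, y)))%:E)%E.
pose H x :=
  mix p0 (fun v => \int[gauss v]_y (g (@tcons R n (x, y)) ^+ 2)%:E)%E.
have G0 x : (0 <= G x)%E.
  by apply: mix_ge0 => // v; apply: integral_ge0 => y _; rewrite lee_fin.
have H0 x : (0 <= H x)%E.
  by apply: mix_ge0 => // v; apply: integral_ge0 => y _; rewrite lee_fin sqr_ge0.
have mG : measurable_fun setT G.
  apply: (measurable_mix _ (J := fun v x => \int[gauss v]_y (EFin \o g) (tcons (x, y))))%E => //.
  by move=> v; apply: measurable_integral_tcons => // x; rewrite lee_fin.
have mH : measurable_fun setT H.
  apply: (measurable_mix _ (J := fun v x => \int[gauss v]_y ((g (tcons (x, y))) ^+ 2)%:E))%E => //.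
  move=> v; apply: (measurable_integral_tcons sigma _ (f := fun x => (g x ^+ 2)%:E)) => // x.
  by rewrite lee_fin sqr_ge0.
have mf p : measurable_fun setT (fun x => (mixture_pdf p x)%:E).
  by apply/measurable_EFinP; exact: measurable_mixture_pdf.
have mchi := measurable_chi2_density p1 f00.
have Gf0 x : (0 <= G x * (mixture_pdf p1 x)%:E)%E.
  by rewrite mule_ge0// lee_fin mixture_pdf_ge0.
have Hf0 x : (0 <= H x * (mixture_pdf p0 x)%:E)%E.
  by rewrite mule_ge0// lee_fin mixture_pdf_ge0.
have mGf := emeasurable_funM mG (mf p1).
have mHf := emeasurable_funM mH (mf p0).
rewrite -ge0_integralZl//; last by move=> x _; exact: Gf0.
rewrite -ge0_integralZl//; last 2 first.
- by move=> x _; exact: Hf0.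
- by rewrite lee_fin ltW.
apply: (@le_trans _ _ (\int[mu]_x (t%:E * (H x * (mixture_pdf p0 x)%:E) +
   (K ^+ n / t)%:E * (mixture_pdf p1 x ^+ 2 / mixture_pdf p0 x)%:E))%E).
  apply: ge0_le_integral => //.
  - by move=> x _; apply: mule_ge0 => //; exact: Gf0.
  - by apply: measurable_funeM => //; exact mGf.
  - apply: emeasurable_funD => //; apply: measurable_funeM => //.
  move=> x _.
  have [f1x0|f1x0] := eqVneq (mixture_pdf p1 x) 0.
    rewrite f1x0 mule0 mule0 expr0n mul0r mule0 adde0.
    by apply: mule_ge0; [rewrite lee_fin ltW|exact: Hf0].
  have f1x : 0 < mixture_pdf p1 x by rewrite lt_def f1x0 mixture_pdf_ge0.
  (* With this choice the two terms, once multiplied by the density f1 of the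
     alternative mixture, become t f0 and f1^2 / (t f0). *)
  have := IH (fun y => g (tcons (x, y))) (t * mixture_pdf p0 x / mixture_pdf p1 x).
  have mgx : measurable_fun setT (fun y => g (@tcons R n (x, y))).
    by apply/measurable_EFinP; exact: measurable_section mg1.
  move=> /(_ mgx (fun y => g0 _)).
  have t'0 : 0 < t * mixture_pdf p0 x / mixture_pdf p1 x.
    by rewrite divr_gt0 ?mulr_gt0.
  move=> /(_ t'0).
  rewrite -/(G x) -/(H x) -(@lee_pmul2r _ (mixture_pdf p1 x)%:E)//.
  rewrite -muleA.
  rewrite ge0_muleDl; last 2 first.
  - by apply: mule_ge0; [rewrite lee_fin ltW|exact: H0].
  - by rewrite lee_fin divr_ge0 ?exprn_ge0// ltW.
  move=> /le_trans; apply; rewrite le_eqVlt; apply/orP; left; apply/eqP.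
  congr (_ + _)%E; last first.
    rewrite -!EFinM; congr EFin; field.
    by rewrite (gt_eqF t0) (gt_eqF (f00 x)) f1x0.
  rewrite muleAC -EFinM [(H x * _)%E]muleC muleA -EFinM; congr (_%:E * _)%E.
  by field; rewrite f1x0.
have chi0 x : 0 <= mixture_pdf p1 x ^+ 2 / mixture_pdf p0 x.
  by rewrite divr_ge0 ?sqr_ge0// ltW.
have Kt0 : 0 <= K ^+ n / t by rewrite divr_ge0 ?exprn_ge0// ltW.
rewrite ge0_integralD//; last 4 first.
- by move=> x _; apply: mule_ge0; [rewrite lee_fin ltW|exact: Hf0].
- by apply: measurable_funeM.
- by move=> x _; apply: mule_ge0; rewrite lee_fin.
- by apply: measurable_funeM.
apply: leeD => //.
rewrite ge0_integralZl//; last by move=> x _; rewrite lee_fin.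
rewrite exprSr mulrAC EFinM.
by apply: (lee_wpmul2l _ HK); rewrite lee_fin.
Qed.

Lemma integral_normal_comb (J : finType) (c m : J -> R) :
  (\int[mu]_x (\sum_j c j * normal_pdf (m j) sigma x)%:E = (\sum_j c j)%:E)%E.
Proof.
under eq_integral do rewrite -sumEFin; rewrite integral_sum//; last first.
  by move=> j; under eq_fun do rewrite EFinM; apply: integrableZl => //;
     exact: integrable_normal_pdf.
rewrite -sumEFin; apply: eq_bigr => j _.
under eq_integral do rewrite EFinM.
by rewrite integralZl// ?integral_normal_pdf ?mule1//; exact: integrable_normal_pdf.
Qed.

(** Completing the square: divided by the centred density, a product of two
    shifted Gaussian densities is again a multiple of a Gaussian density. *)
Lemma normal_pdfM u v x : sigma != 0 ->
  normal_pdf u sigma x * normal_pdf v sigma x =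
  expR (u * v / sigma ^+ 2) * normal_pdf (u + v) sigma x * normal_pdf 0 sigma x.
Proof.
move=> s0; rewrite !normal_pdfE//.
have E : normal_fun u sigma x * normal_fun v sigma x =
    expR (u * v / sigma ^+ 2) * normal_fun (u + v) sigma x * normal_fun 0 sigma x.
  by rewrite /normal_fun -!expRD; congr expR; field.
by rewrite mulrACA E; ring.
Qed.

(** The mass of [p0] at the origin bounds its mixture density f0 from below by
    half the centred density phi. Since
    f1^2 / f0 = 2 f1 - f0 + (f1 - f0)^2 / f0, replacing the last denominator by
    phi / 2 leaves a combination of Gaussian densities, by [normal_pdfM], whose
    integral is the sum of its coefficients. *)
Lemma mixture_chi2_le p0 p1 i0 : sigma != 0 -> prior p0 -> prior p1 ->
  a i0 = 0 -> 1 / 2 <= p0 i0 ->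
  (forall x, 0 < mixture_pdf p0 x) /\
  (\int[mu]_x (mixture_pdf p1 x ^+ 2 / mixture_pdf p0 x)%:E <=
   (1 + 2 * \sum_i \sum_k (p1 i - p0 i) * (p1 k - p0 k)
                        * expR (a i * a k / sigma ^+ 2))%:E)%E.
Proof.
move=> s0 [p00 p01] [p10 p11] ai0 hp0.
have phi0 x : 0 < normal_pdf 0 sigma x.
  by rewrite normal_pdfE// mulr_gt0 ?expR_gt0 ?normal_peak_gt0.
have f0ge x : normal_pdf 0 sigma x / 2 <= mixture_pdf p0 x.
  rewrite /mixture_pdf (bigD1 i0)//= ai0.
  apply: (@le_trans _ _ (p0 i0 * normal_pdf 0 sigma x)).
    by rewrite mulrC ler_pM2r// -(mul1r 2^-1).
  by rewrite lerDl sumr_ge0// => i _; rewrite mulr_ge0 ?normal_pdf_ge0.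
have f00 x : 0 < mixture_pdf p0 x.
  by apply: lt_le_trans (f0ge x); rewrite divr_gt0.
split=> //.
(* The left summand indexes the terms of 2 f1 - f0, the right one those of the
   square. *)
pose c (j : I + I * I) := match j with
  | inl i => 2 * p1 i - p0 i
  | inr (i, k) => 2 * ((p1 i - p0 i) * (p1 k - p0 k)
                        * expR (a i * a k / sigma ^+ 2)) end.
pose m (j : I + I * I) := match j with
  | inl i => a i | inr (i, k) => a i + a k end.
rewrite (_ : 1 + _ = \sum_j c j); last first.
  rewrite big_sumType/= sumrB -mulr_sumr p01 p11 mulr1; congr (_ + _); first lra.
  by rewrite pair_big mulr_sumr/=; apply: eq_bigr => -[i k].
rewrite -(integral_normal_comb c m); apply: ge0_le_integral => //.
- by move=> x _; rewrite lee_fin divr_ge0 ?sqr_ge0// ltW.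
- exact: measurable_chi2_density.
- apply/measurable_EFinP; apply: measurable_sum => j.
  by apply: measurable_funM => //; exact: measurable_normal_pdf.
move=> x _; rewrite lee_fin big_sumType/=.
have -> : \sum_i c (inl i) * normal_pdf (m (inl i)) sigma x =
    2 * mixture_pdf p1 x - mixture_pdf p0 x.
  rewrite /mixture_pdf mulr_sumr -sumrB; apply: eq_bigr => i _ /=; ring.
have -> : \sum_i c (inr i) * normal_pdf (m (inr i)) sigma x =
    2 * ((mixture_pdf p1 x - mixture_pdf p0 x) ^+ 2 / normal_pdf 0 sigma x).
  rewrite /mixture_pdf -sumrB expr2 mulr_suml.
  under [in RHS]eq_bigr do rewrite mulr_sumr.
  rewrite pair_big mulr_suml mulr_sumr; apply: eq_bigr => -[i k] _ /=.
  rewrite -!mulrBl mulrACA normal_pdfM//; field.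
  by rewrite gt_eqF.
set f1 := mixture_pdf p1 x; set f0 := mixture_pdf p0 x.
set phi := normal_pdf 0 sigma x.
have f0x : 0 < f0 := f00 x; have phix : 0 < phi := phi0 x.
have -> : f1 ^+ 2 / f0 = 2 * f1 - f0 + (f1 - f0) ^+ 2 / f0.
  by field; rewrite gt_eqF.
rewrite lerD2l [leRHS]mulrCA ler_wpM2l ?sqr_ge0//.
rewrite ler_pdivlMr// mulrC ler_pdivrMr// -ler_pdivrMl//.
by rewrite mulrC; exact: f0ge.
Qed.

End tensor.

Lemma integral_prob_cst {d} {T : measurableType d} {R : realType}
  (P : probability T R) (c : R) : (\int[P]_x c%:E = c%:E)%E.
Proof. by rewrite integral_cst// [X in (_ * X)%E]probability_setT mule1. Qed.

Lemma expR_le_invr {R : realType} (y : R) : y < 1 -> expR y <= (1 - y)^-1.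
Proof.
move=> y1; rewrite -[leLHS]invrK lef_pV2 ?posrE ?invr_gt0 ?expR_gt0 ?subr_gt0//.
by rewrite -expRN; exact: expR_ge1Dx.
Qed.

Section indistinguishable.
Context {R : realType} {I : finType}.
Variables (sigma : R) (a p0 p1 : I -> R) (i0 : I) (D gamma : R) (n : nat).
Local Notation gauss := (@gauss R _ sigma).

Hypotheses (s0 : sigma != 0) (pr0 : prior p0) (pr1 : prior p1).
Hypotheses (ai0 : a i0 = 0) (hp0 : 1 / 2 <= p0 i0).
Hypotheses (D0 : 0 <= D)
  (chiD : \sum_i \sum_k (p1 i - p0 i) * (p1 k - p0 k)
                        * expR (a i * a k / sigma ^+ 2) <= D).
Hypotheses (gamma01 : 0 < gamma < 1) (nD : n%:R * D <= gamma ^+ 2 / 16).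

Lemma expr_chi2_le : (1 + 2 * D) ^+ n <= 1 + gamma ^+ 2 / 4.
Proof.
have [g0 g1] := andP gamma01.
set z := 2 * (n%:R * D).
have z0 : 0 <= z by rewrite !mulr_ge0.
have zg : z <= gamma ^+ 2 / 8.
  by rewrite /z; move: nD; set w := _ * D => h; lra.
have g2 : gamma ^+ 2 <= 1 by rewrite expr_le1// ltW.
apply: (@le_trans _ _ (expR z)).
  rewrite (_ : z = 2 * D * n%:R); last by rewrite /z; ring.
  rewrite expRM_natr.
  by rewrite lerXn2r ?nnegrE ?expR_ge0 ?addr_ge0 ?mulr_ge0// expR_ge1Dx.
have z1 : 0 < 1 - z by lra.
have : expR z <= (1 - z)^-1 by apply: expR_le_invr; rewrite -subr_gt0.
move=> /le_trans; apply.
rewrite -[leLHS]mul1r ler_pdivrMr//.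
nra.
Qed.

Lemma mix_prob_fin p (F : n.-tuple R -> \bar R) : prior p ->
  (forall v, 0 <= F v <= 1)%E -> exists2 q : R, mix a p F = q%:E & 0 <= q <= 1.
Proof.
move=> [pp0 pp1] F01.
have F0 : (0 <= mix a p F)%E by apply: mix_ge0 => // v; have /andP[] := F01 v.
have F1 : (mix a p F <= 1)%E.
  rewrite -(mix_cst a n 1 pp1); apply: le_mixT => // v.
  by have /andP[] := F01 v.
by case: (mix a p F) F0 F1 => [r r0 r1|//|//]; exists r; rewrite -?lee_fin ?r0.
Qed.

(** [mixture_second_moment] is applied to g = 1_B + c with t = 1 / c and
    c = 2 / gamma. The constant c cancels from both sides, and what remains
    bounds the difference of the two probabilities of B by
    1 / (2c) + (K - 1) c / 2, for K the n-th power of the second moment per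
    coordinate; both terms are at most gamma / 4. *)
Lemma mix_prob_le (B : set (n.-tuple R)) : measurable B ->
  (mix a p1 (fun v => gauss v B) <= mix a p0 (fun v => gauss v B) + (gamma / 2)%:E)%E.
Proof.
move=> mB.
have [g0 g1] := andP gamma01.
have [p00 p01] := pr0; have [p10 p11] := pr1.
have [f00 chi] := mixture_chi2_le s0 pr0 pr1 ai0 hp0.
have {}chi : (\int[lebesgue_measure]_x
    (mixture_pdf sigma a p1 x ^+ 2 / mixture_pdf sigma a p0 x)%:E <= (1 + 2 * D)%:E)%E.
  by apply: (le_trans chi); rewrite lee_fin lerD2l ler_pM2l.
pose c := 2 / gamma.
have c0 : 0 < c by rewrite divr_gt0.
pose g (x : n.-tuple R) : R := \1_B x + c.
have mg : measurable_fun setT g by apply: measurable_funD => //; exact: measurable_indic.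
have g0' x : 0 <= g x by rewrite /g addr_ge0// ltW.
have cV0 : 0 < c^-1 by rewrite invr_gt0.
have := mixture_second_moment p00 p10 f00 chi mg g0' cV0.
have gB v : (0 <= gauss v B <= 1)%E by rewrite measure_ge0 probability_le1.
have B0 x : (0 <= (\1_B x)%:E :> \bar R)%E by rewrite lee_fin.
have mB1 : measurable_fun setT (fun x => (\1_B x)%:E : \bar R).
  by apply/measurable_EFinP; exact: measurable_indic.
have E1 v : (\int[gauss v]_x (g x)%:E = gauss v B + c%:E)%E.
  under eq_integral do rewrite EFinD.
  rewrite ge0_integralD//; last by move=> x _; rewrite lee_fin ltW.
  by rewrite integral_indic// setIT integral_prob_cst.
have E2 v : (\int[gauss v]_x (g x ^+ 2)%:E = (1 + 2 * c)%:E * gauss v B + (c ^+ 2)%:E)%E.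
  transitivity (\int[gauss v]_x ((1 + 2 * c)%:E * (\1_B x)%:E + (c ^+ 2)%:E))%E.
    apply: eq_integral => x _; rewrite -EFinM -EFinD; congr EFin.
    by rewrite /g indicE; case: (x \in B) => /=; ring.
  have cc : 0 <= 1 + 2 * c by lra.
  rewrite ge0_integralD//; last 3 first.
  - by move=> x _; apply: mule_ge0; [rewrite lee_fin|exact: B0].
  - by apply: measurable_funeM.
  - by move=> x _; rewrite lee_fin sqr_ge0.
  by rewrite ge0_integralZl// integral_indic// setIT integral_prob_cst.
rewrite (eq_mix _ _ E1) (eq_mix _ _ E2).
rewrite mixD//; last by move=> v; rewrite lee_fin ltW.
rewrite mixD//; last 2 first.
  by move=> v; rewrite mule_ge0// lee_fin; lra.
  by move=> v; rewrite lee_fin sqr_ge0.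
rewrite mixZl// !mix_cst//.
have [q -> /andP[q0 q1]] := mix_prob_fin pr1 gB.
have [p -> /andP[pp0 pp1]] := mix_prob_fin pr0 gB.
rewrite -[(_ * (q%:E + _))%E]/((2 * (q + c))%:E).
rewrite -[(_%:E * (_ + _) + _)%E]/((c^-1 * ((1 + 2 * c) * p + c ^+ 2)
  + (1 + 2 * D) ^+ n / c^-1)%:E) -EFinD !lee_fin => H.
have K := expr_chi2_le; rewrite invrK in H.
set KK := (1 + 2 * D) ^+ n in K H.
have cg : c * gamma = 2 by rewrite /c divfK// gt_eqF.
have H2 : 2 * (q + c) <= c^-1 * ((1 + 2 * c) * p + c ^+ 2) + (1 + gamma ^+ 2 / 4) * c.
  by apply: (le_trans H); rewrite lerD2l ler_pM2r.
have E3 : c^-1 = gamma / 2 by rewrite /c invf_div.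
rewrite E3 in H2.
nra.
Qed.

(** A further coordinate with the same mean [b] under both priors carries no
    information. *)
Lemma mix_shifted_prob_le (b : R) (A : set (n.+1.-tuple R)) : measurable A ->
  (mix a p1 (fun v => gauss (tcons (b, v)) A) <=
   mix a p0 (fun v => gauss (tcons (b, v)) A) + (gamma / 2)%:E)%E.
Proof.
move=> mA.
have [g0 g1] := andP gamma01.
have [p00 p01] := pr0; have [p10 p11] := pr1.
have A0 (x : n.+1.-tuple R) : (0 <= (\1_A x)%:E :> \bar R)%E by rewrite lee_fin.
have mA1 : measurable_fun setT (fun x => (\1_A x)%:E : \bar R).
  by apply/measurable_EFinP; exact: measurable_indic.
pose S x := [set y | A (@tcons R n (x, y))].
have mS x : measurable (S x).
  have mt : measurable_fun setT (fun y => @tcons R n (x, y)).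
    by apply: (measurable_cons (f := cst x) (g := id)).
  by have := mt measurableT A mA; rewrite setTI.
have E v : gauss (tcons (b, v)) A = (\int[coord_law sigma b]_x gauss v (S x))%E.
  rewrite -[LHS](_ : (\int[gauss (tcons (b, v))]_x (\1_A x)%:E)%E = _); last first.
    by rewrite integral_indic// setIT.
  rewrite integral_gauss_tcons//; apply: eq_integral => x _.
  rewrite -[RHS](_ : (\int[gauss v]_y (\1_(S x) y)%:E)%E = _)//.
  by rewrite integral_indic// setIT.
have mgS v : measurable_fun setT (fun x => gauss v (S x)).
  have := measurable_integral_tcons sigma v mA1 A0.
  congr measurable_fun; apply/funext => x.
  rewrite -[RHS](_ : (\int[gauss v]_y (\1_(S x) y)%:E)%E = _)//.
  by rewrite integral_indic// setIT.
rewrite !(eq_mix _ _ E).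
rewrite !mix_integral//.
have -> : (gamma / 2)%:E = (\int[coord_law sigma b]_x (gamma / 2)%:E)%E.
  by rewrite integral_prob_cst.
rewrite -ge0_integralD//; last 3 first.
- by move=> x _; exact: mix_ge0.
- exact: (measurable_mix _ (J := fun v x => gauss v (S x))).
- by move=> x _; rewrite lee_fin divr_ge0// ltW.
apply: ge0_le_integral => //.
- by move=> x _; exact: mix_ge0.
- exact: (measurable_mix _ (J := fun v x => gauss v (S x))).
- apply: emeasurable_funD => //.
  exact: (measurable_mix _ (J := fun v x => gauss v (S x))).
- by move=> x _; exact: mix_prob_le.
Qed.

End indistinguishable.

(** * From indistinguishable priors to the minimax risk *)

Arguments gauss : simpl never.

Section reduction.
Context {R : realType} {I : finType}.
Variables (sigma : R) (a p0 p1 : I -> R) (i0 : I) (D gamma : R) (n : nat).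
Local Notation gauss := (@gauss R _ sigma).

Lemma l1norm_tcons k b (v : k.-tuple R) : l1norm (tcons (b, v)) = `|b| + l1norm v.
Proof.
rewrite /l1norm big_ord_recl; congr (_ + _).
by apply: eq_bigr => i _; rewrite /tcons /= tnthS.
Qed.

(** Le Cam's two-prior argument. The null prior satisfies its constraint, with
    a radius [B] possibly much smaller than [eps0], with high probability only.
    The rest of the budget, [eps0 - B], is placed on one more coordinate that
    is the same under both priors, so that the alternative exceeds [eps0], and
    not [B], by the difference [n%:R * u - B] of the l1 norms. *)
Lemma minimax_risk_ge (alpha beta eps0 eps1 u B : R) :
  sigma != 0 -> prior p0 -> prior p1 ->
  a i0 = 0 -> 1 / 2 <= p0 i0 ->
  0 <= D -> \sum_i \sum_k (p1 i - p0 i) * (p1 k - p0 k)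
                        * expR (a i * a k / sigma ^+ 2) <= D ->
  0 < 1 - alpha - beta < 1 -> n%:R * D <= (1 - alpha - beta) ^+ 2 / 16 ->
  0 <= B <= eps0 ->
  (mix a p0 (fun v : n.-tuple R => ((B < l1norm v)%R%:R)%:E) <=
   ((1 - alpha - beta) / 2)%:E)%E ->
  (forall i, p1 i != 0 -> u <= `|a i|) -> eps1 <= eps0 + n%:R * u - B ->
  (beta%:E <= @minimax_risk R n.+1 sigma alpha eps0 eps1)%E.
Proof.
move=> s0 pr0 pr1 ai0 hp0 D0 hD g01 nD /andP[B0 Be] hB hu he.
have [p00 p01] := pr0; have [p10 p11] := pr1.
apply: le_ereal_inf_tmp => _ [psi [mpsi t1] <-].
rewrite leNgt; apply/negP => t2.
(* Risks are extended reals; the argument below is an inequality between real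
   numbers. *)
have [b' [b'b t2b']] : exists b', b' < beta /\ (type2_risk sigma eps1 psi <= b'%:E)%E.
  case: (type2_risk sigma eps1 psi) t2 => [r||].
  - by rewrite lte_fin => rb; exists r.
  - by [].
  - by exists (beta - 1); split; [lra|rewrite leNye].
pose b := eps0 - B.
have b0 : 0 <= b by rewrite subr_ge0.
have mpos c : measurable [set x | psi x = c].
  have := mpsi measurableT [set c]; rewrite setTI; apply.
  by [].
pose A := [set x | psi x = true].
have alpha0 : 0 <= alpha.
  rewrite -lee_fin; apply: le_trans t1.
  apply: (@le_trans _ _ (gauss [tuple 0 | _ < n.+1] A)); first exact: measure_ge0.
  apply: ereal_sup_ubound; exists [tuple 0 | _ < n.+1] => //.
  rewrite /null_hyp /= /l1norm big1 ?(le_trans B0)//.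
  by move=> i _; rewrite tnth_mktuple normr0.
have H1 : (mix a p0 (fun v => gauss (tcons (b, v)) A) <=
           (alpha + (1 - alpha - beta) / 2)%:E)%E.
  apply: (@le_trans _ _ (mix a p0 (fun v : n.-tuple R => alpha%:E +
     ((B < l1norm v)%R%:R)%:E)%E)).
    apply: le_mixT => // v; case: (ltP B (l1norm v)) => hv /=.
      apply: (@le_trans _ _ 1%E); first exact: (probability_le1 (gauss (tcons (b, v))) (mpos true)).
      by rewrite -EFinD lee_fin lerDr.
    rewrite adde0; apply: le_trans t1; apply: ereal_sup_ubound.
    exists (tcons (b, v)) => //; rewrite /null_hyp /= l1norm_tcons ger0_norm//.
    by rewrite /b; lra.
  rewrite mixD//.
  by rewrite mix_cst// EFinD leeD2l.
have H2 : ((1 - b')%:E <= mix a p1 (fun v => gauss (tcons (b, v)) A))%E.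
  rewrite -(mix_cst a n (1 - b') p11).
  apply: (@le_mix _ _ _ _ [set x | u <= `|x|]) => // v Sv.
  have hv : (gauss (tcons (b, v)) [set x | psi x = false] <= b'%:E)%E.
    apply: le_trans t2b'; apply: ereal_sup_ubound.
    exists (tcons (b, v)) => //; rewrite /alt_hyp /= l1norm_tcons ger0_norm//.
    have : n%:R * u <= l1norm v.
      rewrite (_ : n%:R * u = \sum_(i < n) u).
        by apply: ler_sum => i _; exact: Sv.
      by rewrite sumr_const card_ord mulr_natl.
    by rewrite /b; lra.
  rewrite EFinB leeBlDr// -[X in (X <= _)%E](@probability_setT _ _ _ (gauss (tcons (b, v)))).
  rewrite (_ : setT = A `|` [set x | psi x = false]); last first.
    by apply/seteqP; split => x //= _; rewrite /A /=; case: (psi x); [left|right].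
  rewrite measureU//; [by rewrite leeD2l|exact: mpos|].
  by apply/seteqP; split => x //= []; rewrite /A /= => ->.
have := mix_shifted_prob_le s0 pr0 pr1 ai0 hp0 D0 hD g01 nD b (mpos true).
move=> /(le_trans H2) H3.
have := le_trans H3 (leeD2r _ H1).
by rewrite -EFinD lee_fin; lra.
Qed.

End reduction.

(** * Dense priors *)

Section dense.
Context {R : realType}.

Lemma mix_markov {I : finType} (a p : I -> R) n (B eta : R) :
  prior p -> 0 < B -> n%:R * \sum_i p i * `|a i| <= eta * B ->
  (mix a p (fun v : n.-tuple R => ((B < l1norm v)%R%:R)%:E) <= eta%:E)%E.
Proof.
move=> [p0 p1] B0 H.
apply: (@le_trans _ _ (mix a p (fun v : n.-tuple R => B^-1%:E * (l1norm v)%:E)))%E.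
  apply: le_mixT => // v; rewrite -EFinM lee_fin mulrC ler_pdivlMr//.
  case: ltP => hv; first by rewrite mul1r ltW.
  by rewrite mul0r sumr_ge0.
rewrite mixZl//; last by move=> v; rewrite lee_fin sumr_ge0.
by rewrite mix_l1norm// -EFinM lee_fin mulrC ler_pdivrMr.
Qed.

(** The origin is tested against independent signs with magnitude [sigma * t].
    The divergence per coordinate is cosh (t^2) - 1, of order t^4, because the
    symmetric prior has the same first moment as the origin. *)
Lemma minimax_risk_ge_dense (alpha beta sigma eps0 eps1 t : R) (n : nat) :
  0 < 1 - alpha - beta < 1 -> 0 < sigma -> 0 <= eps0 ->
  0 <= t -> t ^+ 2 <= 1 / 2 ->
  n%:R * (2 * t ^+ 4) <= (1 - alpha - beta) ^+ 2 / 16 ->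
  eps1 <= eps0 + n%:R * (sigma * t) ->
  (beta%:E <= @minimax_risk R n.+1 sigma alpha eps0 eps1)%E.
Proof.
move=> g01 s0 e0 t0 t1 nt he.
pose a (i : 'I_3) := if val i == 0%N then 0 else if val i == 1%N then sigma * t else - (sigma * t).
pose p0 (i : 'I_3) : R := if val i == 0%N then 1 else 0.
pose p1 (i : 'I_3) : R := if val i == 0%N then 0 else 1 / 2.
have pr0 : prior p0.
  split; first by move=> i; rewrite /p0; case: ifP.
  by rewrite !big_ord_recl big_ord0 /p0 /=; lra.
have pr1 : prior p1.
  split; first by move=> i; rewrite /p1; case: ifP => // _; lra.
  by rewrite !big_ord_recl big_ord0 /p1 /=; lra.
apply: (@minimax_risk_ge R 'I_3 sigma a p0 p1 ord0 (2 * t ^+ 4) n alpha beta eps0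
          eps1 (sigma * t) 0) => //.
- by rewrite gt_eqF.
- by rewrite /p0 /=; lra.
- by rewrite mulr_ge0// exprn_ge0.
- have sn0 : sigma != 0 by rewrite gt_eqF.
  pose y := t ^+ 2.
  have y0 : 0 <= y by rewrite sqr_ge0.
  rewrite !big_ord_recl !big_ord0 /p0 /p1 /a /=.
  rewrite !(mul0r, mulr0, mulrN, mulNr, opprK).
  have -> : sigma * t * (sigma * t) / sigma ^+ 2 = y by rewrite /y; field.
  rewrite expR0.
  have h1 : expR y <= (1 - y)^-1 by apply: expR_le_invr; rewrite /y; lra.
  have h2 : expR (- y) <= (1 + y)^-1.
    by rewrite -[in leRHS](opprK y); apply: expR_le_invr; lra.
  have -> : t ^+ 4 = y ^+ 2 by rewrite /y -exprM.
  have h3 : (1 - y)^-1 + (1 + y)^-1 <= 2 + 4 * y ^+ 2.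
    have yl : y <= 1 / 2 by [].
    have d1 : 0 < 1 - y by lra.
    have d2 : 0 < 1 + y by lra.
    have -> : (1 - y)^-1 + (1 + y)^-1 = 2 / ((1 - y) * (1 + y)).
      by field; rewrite !gt_eqF.
    rewrite ler_pdivrMr ?mulr_gt0// -subr_ge0.
    rewrite (_ : _ - _ = 2 * (y ^+ 2 * (1 - 2 * y ^+ 2))); last by ring.
    have y2 : y ^+ 2 <= (1 / 2) ^+ 2 by rewrite lerXn2r ?nnegrE//; lra.
    by rewrite !mulr_ge0 ?sqr_ge0//; lra.
  lra.
- by rewrite lexx.
- rewrite -[leRHS]adde0 -[X in (_ <= X + _)%E]/((1 - alpha - beta) / 2)%:E.
  apply: (@le_trans _ _ (mix a p0 (fun v : n.-tuple R => 0%:E))); last first.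
    rewrite mix_cst ?adde0 ?lee_fin; [|by case: pr0].
    by case/andP: g01 => /ltW ? _; rewrite divr_ge0.
  have [p00 _] := pr0.
  apply: (@le_mix _ _ _ _ [set 0]) => //.
    by move=> i; rewrite /p0 /a; case: ifP => // _; rewrite eqxx.
  move=> v v0; rewrite /l1norm big1 ?ltxx// => i _.
  by rewrite (v0 i) normr0.
- move=> i; rewrite /p1 /a; case: ifP => [_|_ _]; first by rewrite eqxx.
  by case: ifP => _; rewrite ?normrN ger0_norm// mulr_ge0// ltW.
- by rewrite subr0.
Qed.

End dense.

(** * Priors with matching moments *)

Section exp_tail.
Context {R : realType}.

Lemma expR_taylor_le (t : R) K : `|t| <= 1 / 4 ->
  `|expR t - \sum_(k < K) t ^+ k / k`!%:R| <= 4 / 3 * (1 / 4) ^+ K.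
Proof.
move=> t1.
have tail n : `|\sum_(K <= k < K + n) exp_coeff t k| <=
    4 / 3 * ((1 / 4) ^+ K - (1 / 4) ^+ (K + n)).
  elim: n => [|n IH]; first by rewrite addn0 big_geq// normr0 subrr mulr0.
  rewrite addnS big_nat_recr ?leq_addr//=.
  apply: le_trans (ler_normD _ _) _.
  have h : `|exp_coeff t (K + n)| <= (1 / 4) ^+ (K + n).
    rewrite /exp_coeff normrM normrX normfV normr_nat.
    apply: (@le_trans _ _ (`|t| ^+ (K + n))).
      rewrite ler_piMr ?exprn_ge0// invf_le1 ?ltr0n ?fact_gt0//.
      by rewrite ler1n fact_gt0.
    by rewrite lerXn2r ?nnegrE.
  apply: le_trans (lerD IH h) _.
  by rewrite (exprS _ (K + n)); lra.
have E n : series (exp_coeff t) (n + K)%N - \sum_(k < K) t ^+ k / k`!%:R =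
    \sum_(K <= k < K + n) exp_coeff t k.
  rewrite /series /= addnC (@big_cat_nat _ _ _ K) ?leq_addr//= big_mkord.
  by rewrite addrAC subrr add0r.
have cv : series (exp_coeff t) (n + K)%N @[n --> \oo] --> expR t.
  by have := is_cvg_series_exp_coeff t; rewrite -(cvg_shiftn K).
have cv2 : `|series (exp_coeff t) (n + K)%N - \sum_(k < K) t ^+ k / k`!%:R|
    @[n --> \oo] --> `|expR t - \sum_(k < K) t ^+ k / k`!%:R|.
  apply: cvg_norm; apply: cvgB => //; exact: cvg_cst.
rewrite -(cvg_lim _ cv2)//; apply: limr_le; first by apply/cvg_ex; eexists; exact: cv2.
apply: nearW => n; rewrite E; apply: le_trans (tail n) _.
by rewrite ler_pM2l// gerBl exprn_ge0.
Qed.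

(** The terms of degree k in the expansion of exp (a_i a_j) sum to the square
    of a k-th moment of [w], which vanishes for k < [K]; what is left is the
    tail of the exponential series, at most geometric as |a_i a_j| <= 1/4. *)
Lemma moment_matching_exp_sum {I : finType} (a w : I -> R) K S :
  (forall i, `|a i| <= 1 / 2) -> \sum_i `|w i| <= S ->
  (forall k, (k < K)%N -> \sum_i w i * a i ^+ k = 0) ->
  \sum_i \sum_j w i * w j * expR (a i * a j) <= 4 / 3 * (1 / 4) ^+ K * S ^+ 2.
Proof.
move=> a1 wS mom.
pose P t := \sum_(k < K) t ^+ k / k`!%:R : R.
have P0 : \sum_i \sum_j w i * w j * P (a i * a j) = 0.
  transitivity (\sum_(k < K) (\sum_i w i * a i ^+ k) ^+ 2 / k`!%:R).
    under eq_bigr do under eq_bigr do rewrite mulr_sumr.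
    under eq_bigr do rewrite exchange_big.
    rewrite exchange_big; apply: eq_bigr => k _ /=.
    rewrite expr2 -mulrA mulr_suml; apply: eq_bigr => i _.
    rewrite mulr_suml mulr_sumr; apply: eq_bigr => j _.
    by rewrite exprMn; ring.
  by apply: big1 => k _; rewrite mom// expr0n mul0r.
rewrite -[leLHS]subr0 -[X in _ - X]P0 -sumrB.
have S0 : 0 <= \sum_i `|w i| by exact: sumr_ge0.
apply: (@le_trans _ _ (4 / 3 * (1 / 4) ^+ K * (\sum_i `|w i|) ^+ 2)); last first.
  rewrite ler_wpM2l ?mulr_ge0 ?exprn_ge0//.
  by rewrite lerXn2r ?nnegrE// (le_trans S0).
rewrite expr2 mulrA [X in _ <= X * _]mulr_sumr mulr_suml; apply: ler_sum => i _.
rewrite -sumrB mulr_sumr; apply: ler_sum => j _.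
rewrite -mulrBr; apply: le_trans (ler_norm _) _.
rewrite !normrM mulrC [leRHS](_ : _ = 4 / 3 * (1 / 4) ^+ K * (`|w i| * `|w j|)); last by ring.
rewrite ler_wpM2r ?mulr_ge0//.
apply: expR_taylor_le; rewrite normrM.
rewrite (_ : 1 / 4 = 1 / 2 * (1 / 2)); last by field.
by rewrite ler_pM.
Qed.

End exp_tail.

Section finite_difference.
Context {R : realType}.

(** The m-th finite difference of a polynomial of degree less than m is 0. *)
Lemma alternating_binomial_pow (m k : nat) (y : R) : (k < m)%N ->
  \sum_(j < m.+1) (-1) ^+ j * 'C(m, j)%:R * (y + j%:R) ^+ k = 0.
Proof.
elim: k m y => [|k IH] m y km.
  transitivity ((1 - 1 : R) ^+ m).
    rewrite exprDn; apply: eq_bigr => j _.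
    by rewrite expr1n mul1r expr0 mulr1 mulr_natr.
  by rewrite subrr expr0n; case: m km.
case: m km => // m km.
transitivity (y * (\sum_(j < m.+2) (-1) ^+ j * 'C(m.+1, j)%:R * (y + j%:R) ^+ k)
  + \sum_(j < m.+2) (-1) ^+ j * (j * 'C(m.+1, j))%:R * (y + j%:R) ^+ k).
  rewrite mulr_sumr -big_split; apply: eq_bigr => j _ /=.
  by rewrite exprS natrM; ring.
rewrite IH ?(ltn_trans _ km)// mulr0 add0r big_ord_recl/= mul0n mulr0 mul0r add0r.
transitivity (- m.+1%:R * \sum_(j < m.+1) (-1) ^+ j * 'C(m, j)%:R * ((y + 1) + j%:R) ^+ k).
  rewrite mulr_sumr; apply: eq_bigr => j _.
  rewrite /bump leq0n add1n -mul_bin_diag natrM exprS -(natr1 j).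
  by rewrite (_ : y + (j%:R + 1) = y + 1 + j%:R); [ring|ring].
by rewrite IH// mulr0.
Qed.

End finite_difference.

Lemma bin_central_le (N j : nat) : (j <= 2 * N)%N ->
  ('C(2 * N, j) <= 'C(2 * N, N))%N.
Proof.
have low i : (i <= N)%N -> ('C(2 * N, N - i) <= 'C(2 * N, N))%N.
  elim: i => [|i IH] iN; first by rewrite subn0.
  apply: leq_trans (IH (ltnW iN)).
  rewrite -(subnSK iN) -(@leq_pmul2l (N - i.+1).+1)// mul_bin_left.
  by rewrite leq_mul2r; apply/orP; right; lia.
move=> jN; have [j1|j1] := leqP j N.
  by rewrite -(subKn j1); apply: low; exact: leq_subr.
rewrite -(bin_sub jN) (_ : 2 * N - j = N - (j - N))%N; last by lia.
by apply: low; lia.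
Qed.

(** The finite difference weights (-1)^x 'C(2N, N + x) at the integers x of
    [-N, N] annihilate all polynomials of degree less than 2N. After division
    by x^2 - h^2 they annihilate (x^2 - h^2) x^k for k < 2N, so the moments of
    the new weights [coef] satisfy m_(k+2) = h^2 m_k: up to degree 2N+1 they
    are the moments of a symmetric pair of masses at +-h. Cancelling them by
    the masses [w / 2] at +-h gives the signed measure [delta]. The central
    weight is normalized to -1 and the others are O(h^2 / x^2), so that for
    small h the negative mass of [delta] is mostly at 0 and the positive mass
    mostly at +-h; the negative and positive parts are the two priors. The
    atoms are divided by 2N to lie in [-1/2, 1/2]. *)
Section moment_matching.
Context {R : realType}.
Variables (N : nat) (h : R).
Hypotheses (N0 : (0 < N)%N) (h0 : 0 < h) (hN : h <= (2 * N%:R)^-1).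

Let node (j : 'I_(2 * N).+1) : R := j%:R - N%:R.
Let coef (j : 'I_(2 * N).+1) : R :=
  (-1) ^+ (j + N) * ('C(2 * N, j)%:R / 'C(2 * N, N)%:R) *
  (h ^+ 2 / (node j ^+ 2 - h ^+ 2)).
Let mid : 'I_(2 * N).+1 := inord N.

Let valmid : mid = N :> nat.
Proof. by rewrite /mid inordK// ltnS mul2n -addnn leq_addr. Qed.

Let node_mid : node mid = 0.
Proof. by rewrite /node valmid subrr. Qed.

Let hhalf : h <= 1 / 2.
Proof.
apply: (le_trans hN); rewrite mul1r lef_pV2 ?posrE ?mulr_gt0 ?ltr0n//.
by rewrite ler_peMr// ler1n.
Qed.

Let node_sqr j : j != mid -> 1 <= `|node j|.
Proof.
move=> jm; have jN : (j : nat) != N.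
  by apply: contra_neq jm => jN; apply: val_inj; rewrite /= valmid.
rewrite /node; case: (ltngtP j N) jN => // jN _.
  by rewrite distrC ger0_norm ?subr_ge0 ?ler_nat 1?ltnW// lerBrDr nat1r ler_nat.
by rewrite ger0_norm ?subr_ge0 ?ler_nat 1?ltnW// lerBrDr nat1r ler_nat.
Qed.

Let node_le j : `|node j| <= N%:R.
Proof.
rewrite /node ler_norml; apply/andP; split.
  by rewrite lerBrDr addrC subrr.
rewrite lerBlDr -natrD ler_nat addnn -mul2n -ltnS; exact: ltn_ord.
Qed.

Let coef_mid : coef mid = -1.
Proof.
rewrite /coef node_mid valmid addnn -mul2n exprM sqrrN expr1n expr1n mul1r.
rewrite divff ?pnatr_eq0 -?lt0n ?bin_gt0 ?mul2n -?addnn ?leq_addr// mul1r.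
by field; rewrite gt_eqF.
Qed.

Let denom_gt j : j != mid -> 3 / 4 * `|node j| <= node j ^+ 2 - h ^+ 2.
Proof.
move=> jm; have x1 := node_sqr jm.
rewrite -[node j ^+ 2]ger0_norm ?sqr_ge0// normrX.
have h2 : h ^+ 2 <= (1 / 2) ^+ 2 by rewrite lerXn2r ?nnegrE// ltW.
set x := `|node j| in x1 *; nra.
Qed.

(** The first absolute moment of the null prior and the total mass of [delta]
    are both controlled through this decay. *)
Let coef_norm j : j != mid -> `|coef j| * `|node j| <= 4 / 3 * h ^+ 2.
Proof.
move=> jm; have x1 := node_sqr jm; have dg := denom_gt jm.
have d0 : 0 < node j ^+ 2 - h ^+ 2.
  by apply: lt_le_trans dg; rewrite mulr_gt0// (lt_le_trans _ x1).
have C0 : (0 < 'C(2 * N, N))%N by rewrite bin_gt0 mul2n -addnn leq_addr.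
rewrite /coef !normrM normrX normrN1 expr1n mul1r.
rewrite !normfV !normr_nat (gtr0_norm h0) (gtr0_norm d0) -(expr2 h).
apply: (@le_trans _ _ (1 * (h ^+ 2 / (node j ^+ 2 - h ^+ 2)) * `|node j|)).
  have q0 : 0 <= h ^+ 2 / (node j ^+ 2 - h ^+ 2) by rewrite divr_ge0 ?sqr_ge0 1?ltW.
  rewrite ler_wpM2r// ler_wpM2r//.
  by rewrite ler_pdivrMr ?ltr0n// mul1r ler_nat bin_central_le// -ltnS.
rewrite mul1r mulrAC ler_pdivrMr//.
have := sqr_ge0 h; move: dg; set x := `|_|; set y := _ - _; set z := h ^+ 2.
move=> *; nra.
Qed.

Let moment k : R := \sum_j coef j * node j ^+ k.

Let momentSS k : (k < 2 * N)%N -> moment k.+2 = h ^+ 2 * moment k.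
Proof.
move=> kN; apply/eqP; rewrite -subr_eq0; apply/eqP.
rewrite /moment mulr_sumr -sumrB.
transitivity (h ^+ 2 * (-1) ^+ N / 'C(2 * N, N)%:R *
   \sum_(j < (2 * N).+1) (-1) ^+ j * 'C(2 * N, j)%:R * (- N%:R + j%:R) ^+ k).
  rewrite mulr_sumr; apply: eq_bigr => j _.
  have d0 : node j ^+ 2 - h ^+ 2 != 0.
    have [->|jm] := eqVneq j mid.
      by rewrite node_mid expr0n sub0r oppr_eq0 expf_eq0/= gt_eqF.
    rewrite gt_eqF//; apply: lt_le_trans (denom_gt jm).
    by rewrite mulr_gt0// (lt_le_trans _ (node_sqr jm)).
  have C0 : 'C(2 * N, N)%:R != 0 :> R.
    by rewrite pnatr_eq0 -lt0n bin_gt0 mul2n -addnn leq_addr.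
  rewrite (_ : - N%:R + j%:R = node j); last by rewrite addrC.
  rewrite /coef exprD !exprS; move: d0 C0.
  set x := node j; set b := 'C(_, N)%:R => d0 C0; field.
  by rewrite d0 C0.
by rewrite alternating_binomial_pow// mulr0.
Qed.

(** The weights are even. *)
Let moment1 : moment 1 = 0.
Proof.
suff : moment 1 = - moment 1.
  by move/eqP; rewrite -subr_eq0 opprK -mulr2n mulrn_eq0 => /eqP.
rewrite /moment -sumrN (reindex_inj rev_ord_inj); apply: eq_bigr => j _ /=.
have jN : (j <= 2 * N)%N by rewrite -ltnS.
have E : node (rev_ord j) = - node j.
  rewrite /node /= subSS natrB// natrM; ring.
rewrite !expr1 E mulrN; congr (- (_ * _)).
rewrite /coef E sqrrN /= subSS bin_sub//; congr (_ * _ * _).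
rewrite -[LHS]signr_odd -[RHS]signr_odd; congr (_ ^+ (nat_of_bool _)).
by rewrite !oddD oddB// oddM.
Qed.

Let moment_even m : (m <= N)%N -> moment (2 * m) = h ^+ (2 * m) * moment 0.
Proof.
elim: m => [|m IH] mN; first by rewrite muln0 expr0 mul1r.
rewrite mulnS add2n momentSS; last by lia.
by rewrite IH ?(ltnW mN)// mulrA -exprD add2n.
Qed.

Let moment_odd m : (m <= N)%N -> moment (2 * m).+1 = 0.
Proof.
elim: m => [|m IH] mN; first by rewrite muln0 moment1.
have [mN'|] := ltnP (2 * m).+1 (2 * N); last by lia.
by rewrite mulnS add2n momentSS// IH ?(ltnW mN)// mulr0.
Qed.

Let w : R := - moment 0.

Let sum_coef_norm : \sum_(j | j != mid) `|coef j| <= 2 / 3.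
Proof.
apply: (@le_trans _ _ (\sum_(j | j != mid) (4 / 3 * h ^+ 2))).
  apply: ler_sum => j jm; apply: le_trans (coef_norm jm).
  by rewrite ler_peMr// node_sqr.
rewrite sumr_const cardC1 card_ord -[_ *+ (2 * N).+1.-1]mulr_natl.
have N1 : 1 <= N%:R :> R by rewrite ler1n.
have : h ^+ 2 <= ((2 * N%:R)^-1) ^+ 2 by rewrite lerXn2r ?nnegrE ?invr_ge0 ?mulr_ge0// ltW.
rewrite exprVn -[X in _ <= X]mul1r ler_pdivlMr ?exprn_gt0 ?mulr_gt0 ?ltr0n// => H.
rewrite /= natrM; have := sqr_ge0 h; move: H; rewrite exprMn.
set z := h ^+ 2; set n := N%:R in N1 * => H z0; nra.
Qed.

Let sum_coef_bound : `|\sum_(j | j != mid) coef j| <= 2 / 3.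
Proof. by apply: le_trans (ler_norm_sum _ _ _) sum_coef_norm. Qed.

Let w_gt0 : 0 < w.
Proof.
rewrite /w /moment (bigD1 mid)//= expr0 mulr1 coef_mid.
under eq_bigr do rewrite expr0 mulr1.
by have /ler_normlP[] := sum_coef_bound; lra.
Qed.

Let I : finType := ('I_(2 * N).+1 + bool)%type.

Let delta (i : I) : R := match i with inl j => coef j | inr _ => w / 2 end.

Let atom (i : I) : R := (2 * N%:R)^-1 *
  match i with inl j => node j | inr s => if s then h else - h end.

Let total : R := \sum_i `|delta i|.

Let sum_delta_pow k : (k < (2 * N).+2)%N -> \sum_i delta i * atom i ^+ k = 0.
Proof.
move=> kN.
transitivity ((2 * N%:R)^-1 ^+ k * (moment k + w / 2 * (h ^+ k + (- h) ^+ k))).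
  rewrite big_sumType big_bool /= mulrDr; congr (_ + _); last first.
    by rewrite !exprMn; ring.
  by rewrite /moment mulr_sumr; apply: eq_bigr => j _; rewrite exprMn; ring.
suff -> : moment k + w / 2 * (h ^+ k + (- h) ^+ k) = 0 by rewrite mulr0.
have kE := odd_double_half k; have k2 : (k./2 <= N)%N by lia.
rewrite -kE -muln2 mulnC; case: (odd k).
  rewrite add1n moment_odd// add0r exprNn -signr_odd /= oddM /= expr1.
  by rewrite mulN1r subrr mulr0.
by rewrite add0n moment_even// [(- h) ^+ _]exprM sqrrN -exprM /w; field.
Qed.

Let totalE : total = 1 + \sum_(j | j != mid) `|coef j| + w.
Proof.
rewrite /total big_sumType big_bool /= (bigD1 mid)//= coef_mid normrN1.
congr (_ + _); rewrite ger0_norm; first by field.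
by rewrite divr_ge0// ltW.
Qed.

Let wE : w = 1 - \sum_(j | j != mid) coef j.
Proof.
rewrite /w /moment (bigD1 mid)//= expr0 mulr1 coef_mid opprD opprK.
by under eq_bigr do rewrite expr0 mulr1.
Qed.

Let total_ge2 : 2 <= total.
Proof.
rewrite totalE wE.
have : \sum_(j | j != mid) coef j <= \sum_(j | j != mid) `|coef j|.
  by apply: ler_sum => j _; exact: ler_norm.
by lra.
Qed.

Let total_le4 : total <= 4.
Proof.
rewrite totalE wE; have := sum_coef_norm.
by have /ler_normlP[] := sum_coef_bound; lra.
Qed.

Let total_gt0 : 0 < total. Proof. by apply: lt_le_trans total_ge2. Qed.

Let sum_delta : \sum_i delta i = 0.
Proof.
rewrite -[RHS](@sum_delta_pow 0)//.
by apply: eq_bigr => i _; rewrite expr0 mulr1.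
Qed.

Let p0 i := (`|delta i| - delta i) / total.
Let p1 i := (`|delta i| + delta i) / total.

Let prior_p0 : prior p0.
Proof.
split=> [i|].
  by rewrite divr_ge0// ?(ltW total_gt0)// subr_ge0 ler_norm.
by rewrite -mulr_suml sumrB sum_delta subr0 divff// gt_eqF.
Qed.

Let prior_p1 : prior p1.
Proof.
split=> [i|].
  rewrite divr_ge0// ?(ltW total_gt0)// -lerBlDr sub0r.
  by rewrite -normrN ler_norm.
by rewrite -mulr_suml big_split/= sum_delta addr0 divff// gt_eqF.
Qed.

Let atom_le i : `|atom i| <= 1 / 2.
Proof.
have NR : 0 < N%:R :> R by rewrite ltr0n.
have N1 : 1 <= N%:R :> R by rewrite ler1n.
rewrite /atom normrM gtr0_norm ?invr_gt0 ?mulr_gt0//.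
rewrite mulrC ler_pdivrMr ?mulr_gt0// mulrA divfK// mul1r.
case: i => [j|s]; first exact: node_le.
have -> : `|if s then h else - h| = h by case: s; rewrite ?normrN gtr0_norm.
by apply: (le_trans hhalf); lra.
Qed.

Let atom_ge i : p1 i != 0 -> (2 * N%:R)^-1 * h <= `|atom i|.
Proof.
have NR : 0 < N%:R :> R by rewrite ltr0n.
rewrite /atom normrM gtr0_norm ?invr_gt0 ?mulr_gt0// ler_pM2l ?invr_gt0 ?mulr_gt0//.
case: i => [j|s] pn0; last by case: s pn0; rewrite ?normrN gtr0_norm.
have [jm|jm] := eqVneq j mid.
  by move: pn0; rewrite /p1 /= jm coef_mid normrN1 subrr mul0r eqxx.
by apply: (le_trans hhalf); apply: le_trans (node_sqr jm); lra.
Qed.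

Let first_moment_p0 : \sum_i p0 i * `|atom i| <= 4 / 3 * h ^+ 2.
Proof.
have NR : 0 < N%:R :> R by rewrite ltr0n.
have w2 : `|w / 2| = w / 2 by rewrite gtr0_norm// divr_gt0.
rewrite big_sumType big_bool /= {2 3}/p0 /= w2.
rewrite subrr !mul0r !addr0 (bigD1 mid)//= /atom node_mid mulr0 normr0 mulr0 add0r.
apply: (@le_trans _ _ (\sum_(j : 'I_(2 * N).+1 | j != mid)
    (2 * N%:R)^-1 * (4 / 3 * h ^+ 2))).
  apply: ler_sum => j jm; rewrite normrM gtr0_norm ?invr_gt0 ?mulr_gt0//.
  rewrite mulrCA ler_pM2l ?invr_gt0 ?mulr_gt0//.
  apply: le_trans (coef_norm jm); rewrite ler_wpM2r//.
  rewrite /p0 /= ler_pdivrMr//.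
  have := total_ge2; have := ler_norm (- coef j); rewrite normrN.
  have := normr_ge0 (coef j); set x := `|_| => *; nra.
rewrite sumr_const cardC1 card_ord -[_ *+ (2 * N).+1.-1]mulr_natl /= natrM.
by rewrite mulrA divff ?mul1r// gt_eqF// mulr_gt0.
Qed.

Let sum_norm_delta : \sum_i `|p1 i - p0 i| <= 2.
Proof.
have E i : p1 i - p0 i = 2 / total * delta i.
  by rewrite /p1 /p0; field; rewrite gt_eqF.
under eq_bigr do rewrite E normrM gtr0_norm ?divr_gt0//.
by rewrite -mulr_sumr divfK// gt_eqF.
Qed.

Lemma moment_matching_priors :
  exists (I : finType) (i0 : I) (a p0 p1 : I -> R),
  [/\ prior p0, prior p1, a i0 = 0, 1 / 2 <= p0 i0 &
  [/\ forall i, p1 i != 0 -> (2 * N%:R)^-1 * h <= `|a i|,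
       \sum_i p0 i * `|a i| <= 4 / 3 * h ^+ 2 &
       \sum_i \sum_k (p1 i - p0 i) * (p1 k - p0 k) * expR (a i * a k)
         <= (1 / 4) ^+ (2 * N)]].
Proof.
exists I, (inl mid), atom, p0, p1; split=> //.
- by rewrite /atom node_mid mulr0.
- rewrite /p0 /= coef_mid normrN1 opprK ler_pdivlMr//.
  by have := total_le4; lra.
split=> //.
apply: le_trans (moment_matching_exp_sum (K := (2 * N).+2) atom_le sum_norm_delta _) _.
  move=> k kN.
  have E i : (p1 i - p0 i) * atom i ^+ k = 2 / total * (delta i * atom i ^+ k).
    by rewrite /p1 /p0; field; rewrite gt_eqF.
  by under eq_bigr do rewrite E; rewrite -mulr_sumr sum_delta_pow// mulr0.
rewrite !exprS; have : 0 <= (1 / 4 : R) ^+ (2 * N) by rewrite exprn_ge0.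
by set x := _ ^+ (2 * N); lra.
Qed.

End moment_matching.

(** * Sparse priors *)

Section sparse.
Context {R : realType}.

(** The null prior of [moment_matching_priors] has expected l1 norm
    O(n sigma N^2 u^2) when the atoms of the alternative have magnitude at
    least [sigma * u]; Markov's inequality makes [B] a radius exceeded with
    probability at most [(1 - alpha - beta) / 2]. *)
Lemma minimax_risk_ge_sparse (alpha beta sigma eps0 eps1 u : R) (n N : nat) :
  0 < 1 - alpha - beta < 1 -> 0 < sigma ->
  (0 < n)%N -> (0 < N)%N -> 0 < u -> u <= (4 * N%:R ^+ 2)^-1 ->
  n%:R * (1 / 4) ^+ (2 * N) <= (1 - alpha - beta) ^+ 2 / 16 ->
  let B := n%:R * (sigma * (12 * N%:R ^+ 2 * u ^+ 2)) / (1 - alpha - beta) in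
  B <= eps0 -> eps1 <= eps0 + n%:R * (sigma * u) - B ->
  (beta%:E <= @minimax_risk R n.+1 sigma alpha eps0 eps1)%E.
Proof.
move=> g01 s0 n0 N0 u0 uN nD B Be he.
have NR : 0 < N%:R :> R by rewrite ltr0n.
have nR : 0 < n%:R :> R by rewrite ltr0n.
have g0 : 0 < 1 - alpha - beta by case/andP: g01.
pose h := 2 * N%:R * u.
have h0 : 0 < h by rewrite !mulr_gt0.
have hN : h <= (2 * N%:R)^-1.
  rewrite -div1r ler_pdivlMr ?mulr_gt0//.
  move: uN; rewrite -div1r ler_pdivlMr ?mulr_gt0 ?exprn_gt0//.
  by apply: le_trans; rewrite le_eqVlt; apply/orP; left; apply/eqP; rewrite /h; ring.
have [I [i0 [a [p0 [p1 [pr0 pr1 ai0 hp0 [au m0 hD]]]]]]] :=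
  moment_matching_priors N0 h0 hN.
have B0 : 0 < B by rewrite divr_gt0// !mulr_gt0 ?exprn_gt0.
apply: (@minimax_risk_ge R I sigma (fun i => sigma * a i) p0 p1 i0
  ((1 / 4) ^+ (2 * N)) n alpha beta eps0 eps1 (sigma * u) B) => //.
- by rewrite gt_eqF.
- by rewrite ai0 mulr0.
- apply: le_trans hD; rewrite le_eqVlt; apply/orP; left; apply/eqP.
  apply: eq_bigr => i _; apply: eq_bigr => k _; congr (_ * expR _).
  by field; rewrite gt_eqF.
- by rewrite ltW.
- apply: mix_markov => //.
  under eq_bigr do rewrite normrM gtr0_norm// mulrCA.
  rewrite -mulr_sumr.
  apply: (@le_trans _ _ (n%:R * (sigma * (4 / 3 * h ^+ 2)))).
    by rewrite !ler_pM2l.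
  rewrite (_ : _ / 2 * B = n%:R * (sigma * (6 * N%:R ^+ 2 * u ^+ 2))); last first.
    by rewrite /B; field; rewrite gt_eqF.
  rewrite !ler_pM2l// /h -subr_ge0.
  rewrite (_ : _ - _ = 2 / 3 * (N%:R ^+ 2 * u ^+ 2)); last by field.
  by apply: mulr_ge0; [lra|rewrite mulr_ge0 ?sqr_ge0].
- move=> i /au; rewrite normrM gtr0_norm// ler_pM2l//.
  by rewrite /h mulrA mulVf ?mul1r// gt_eqF// mulr_gt0.
Qed.

End sparse.

(** * Absolute moments of one Gaussian coordinate *)

(** Locked, so that means are compared through [mean_absE] only and never by
    unfolding the integrals behind them. *)
HB.lock Definition mean_abs {R : realType} (sigma v : R) : R :=
  fine (\int[coord_law sigma v]_x `|x|%:E)%E.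

Section coordinate_moments.
Context {R : realType}.
Variable sigma : R.
Hypothesis s0 : 0 < sigma.
Local Notation mu := (@lebesgue_measure R).
Local Notation N := (coord_law sigma).

Let sn0 : sigma != 0. Proof. by rewrite gt_eqF. Qed.

Lemma lebesgue_measure_translate (v : R) (A : set R) : measurable A ->
  pushforward mu (fun x : measurableTypeR R => (x + v : measurableTypeR R)) A = mu A.
Proof.
move=> mA.
have mt : measurable_fun setT (fun x : measurableTypeR R => (x + v : measurableTypeR R)).
  exact: measurable_funD.
apply/esym/lebesgue_measure_unique => //= _ [[a b]] _ <-.
rewrite /pushforward/= (_ : _ @^-1` _ = `]a - v, b - v]%classic); last first.
  by apply/seteqP; split => x /=; rewrite !in_itv/= ltrBlDr lerBrDr.
rewrite !lebesgue_measure_itv/= !lte_fin ltrD2r -!EFinB.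
by case: ifP => // _; congr EFin; ring.
Qed.

Lemma integral_lebesgue_translate (v : R) (f : R -> \bar R) :
  measurable_fun setT f -> (forall x, 0 <= f x)%E ->
  (\int[mu]_x f (x + v)%R = \int[mu]_x f x)%E.
Proof.
move=> mf f0.
have mt : measurable_fun setT (fun x : measurableTypeR R => (x + v : measurableTypeR R)).
  exact: measurable_funD.
rewrite -[LHS](ge0_integral_pushforward mt mu measurableT mf (fun x _ => f0 x)).
apply: eq_measure_integral => //= A mA _.
exact: lebesgue_measure_translate.
Qed.

Lemma integral_lebesgue_opp (f : R -> \bar R) :
  measurable_fun setT f -> (forall x, 0 <= f x)%E ->
  (\int[mu]_x f (- x)%R = \int[mu]_x f x)%E.
Proof.
move=> mf f0.
have mt : measurable_fun setT (-%R : measurableTypeR R -> measurableTypeR R).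
  exact: measurable_funN.
rewrite -[LHS](ge0_integral_pushforward mt mu measurableT mf (fun x _ => f0 x)).
apply: eq_measure_integral => //= A mA _.
exact: lebesgue_measureN.
Qed.

Let mpdf v : measurable_fun setT (fun x => (normal_pdf v sigma x)%:E).
Proof. by apply/measurable_EFinP; exact: measurable_normal_pdf. Qed.

Lemma integral_coord_law_shift v (f : R -> \bar R) :
  measurable_fun setT f -> (forall x, 0 <= f x)%E ->
  (\int[N v]_x f x = \int[N 0]_x f (x + v)%R)%E.
Proof.
move=> mf f0.
have mfv : measurable_fun setT (fun x : R => f (x + v)).
  by apply: (measurableT_comp mf); exact: measurable_funD.
apply: eq_trans (esym (ge0_integral_coord_law sigma 0 mfv (fun x => f0 (x + v)))).
apply: eq_trans (ge0_integral_coord_law sigma v mf f0) _.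
have mfp := emeasurable_funM mf (mpdf v).
have fp0 x : (0 <= f x * (normal_pdf v sigma x)%:E)%E.
  by rewrite mule_ge0 ?lee_fin ?normal_pdf_ge0.
rewrite -[LHS](integral_lebesgue_translate v mfp fp0).
apply: eq_integral => x _; congr (_ * _%:E)%E.
by rewrite !normal_pdfE// /normal_fun addrK subr0.
Qed.

Lemma integral_coord_law_opp (f : R -> \bar R) :
  measurable_fun setT f -> (forall x, 0 <= f x)%E ->
  (\int[N 0]_x f (- x)%R = \int[N 0]_x f x)%E.
Proof.
move=> mf f0.
have mfv : measurable_fun setT (fun x : R => f (- x)).
  by apply: (measurableT_comp mf); exact: measurable_funN.
rewrite (ge0_integral_coord_law sigma 0 mf f0).
rewrite (ge0_integral_coord_law sigma 0 mfv (fun x => f0 (- x))).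
have mfp := emeasurable_funM mf (mpdf 0).
have fp0 x : (0 <= f x * (normal_pdf 0 sigma x)%:E)%E.
  by rewrite mule_ge0 ?lee_fin ?normal_pdf_ge0.
rewrite -[RHS](integral_lebesgue_opp mfp fp0).
apply: eq_integral => x _; congr (_ * _%:E)%E.
by rewrite !normal_pdfE// /normal_fun !subr0 sqrrN.
Qed.

(** The noise is symmetric, so f (x + v) may be averaged with f (x - v); the
    sum of the two is what pointwise bounds are available for. *)
Lemma integral_coord_law_even v (f : R -> R) :
  measurable_fun setT f -> (forall x, 0 <= f x) -> (forall x, f (- x) = f x) ->
  (2%:E * \int[N v]_x (f x)%:E = \int[N 0]_x (f (x + v) + f (x - v))%:E)%E.
Proof.
move=> mf f0 fN.
have mfv w : measurable_fun setT (fun x : R => f (x + w)).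
  by apply: (measurableT_comp mf); exact: measurable_funD.
have mfv' w : measurable_fun setT (fun x : R => (f (x + w))%:E) by apply/measurable_EFinP.
have mfE : measurable_fun setT (fun x => (f x)%:E) by apply/measurable_EFinP.
apply: (eq_trans (congr1 (fun z => 2%:E * z)%E (integral_coord_law_shift v mfE f0))).
under [RHS]eq_integral do rewrite EFinD.
rewrite ge0_integralD//; [|by move=> x _; rewrite lee_fin..].
rewrite -[X in (_ = _ + X)%E]integral_coord_law_opp//; [|by move=> x; rewrite lee_fin].
under [X in (_ = _ + X)%E]eq_integral do rewrite -opprD fN.
by rewrite (_ : 2%:E = 1 + 1)%E// ge0_muleDl// !mul1e.
Qed.

(** x^2 is absorbed by the ratio of the densities with deviations 2 sigma and
    sigma, an exponential in x^2 / sigma^2 that is bounded below by an affine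
    function. *)
Lemma second_moment_centered : (\int[N 0]_x (x ^+ 2)%:E <= (6 * sigma ^+ 2)%:E)%E.
Proof.
rewrite ge0_integral_coord_law//; [|by apply/measurable_EFinP|by move=> x; rewrite lee_fin sqr_ge0].
have -> : (6 * sigma ^+ 2)%:E = (\int[mu]_x ((6 * sigma ^+ 2)%:E * (normal_pdf 0 (2 * sigma) x)%:E))%E.
  rewrite integralZl//; last exact: integrable_normal_pdf.
  by rewrite integral_normal_pdf mule1.
have s2 : 2 * sigma != 0 by rewrite mulf_neq0.
apply: ge0_le_integral => //.
- by move=> x _; rewrite -EFinM lee_fin mulr_ge0 ?sqr_ge0 ?normal_pdf_ge0.
- apply: (emeasurable_funM _ (mpdf 0)); exact/measurable_EFinP.
- apply: measurable_funeM => //; apply/measurable_EFinP; exact: measurable_normal_pdf.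
move=> x _; rewrite -!EFinM lee_fin !normal_pdfE//.
have -> : normal_peak sigma = 2 * normal_peak (2 * sigma).
  rewrite /normal_peak (_ : (2 * sigma) ^+ 2 * pi *+ 2 = 2 ^+ 2 * (sigma ^+ 2 * pi *+ 2)).
    rewrite sqrtrM ?sqr_ge0// sqrtr_sqr ger0_norm// invfM.
    by rewrite mulrA mulfV// mul1r.
  by rewrite exprMn -[2 ^+ 2 * _ * _]mulrA -mulrnAr.
rewrite /normal_fun !subr0.
set p := normal_peak _.
have p0 : 0 < p by exact: normal_peak_gt0.
pose y := 3 / 8 * (x ^+ 2 / sigma ^+ 2).
have E : expR (- x ^+ 2 / ((2 * sigma) ^+ 2 *+ 2)) =
    expR (- x ^+ 2 / (sigma ^+ 2 *+ 2)) * expR y.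
  by rewrite -expRD /y; congr expR; field.
rewrite E; set e := expR (- x ^+ 2 / _); have e0 : 0 < e by exact: expR_gt0.
rewrite (_ : 6 * sigma ^+ 2 * _ = p * e * (6 * sigma ^+ 2 * expR y)); last by ring.
rewrite (_ : x ^+ 2 * _ = p * e * (2 * x ^+ 2)); last by ring.
rewrite ler_pM2l ?mulr_gt0//.
have ey : 1 + y <= expR y by exact: expR_ge1Dx.
apply: (@le_trans _ _ (6 * sigma ^+ 2 * y)).
  rewrite /y [leRHS](_ : _ = 9 / 4 * x ^+ 2); last by field.
  by have := sqr_ge0 x; lra.
by rewrite ler_pM2l ?mulr_gt0 ?exprn_gt0//; lra.
Qed.

Lemma second_moment v : (\int[N v]_x (x ^+ 2)%:E <= (v ^+ 2 + 6 * sigma ^+ 2)%:E)%E.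
Proof.
rewrite -(@lee_pmul2l _ 2%:E)// integral_coord_law_even//; [|by move=> x; rewrite sqr_ge0|by move=> x; rewrite sqrrN].
under eq_integral.
  move=> x _; rewrite (_ : (x + v) ^+ 2 + (x - v) ^+ 2 = 2 * x ^+ 2 + 2 * v ^+ 2); last by ring.
  rewrite EFinD EFinM; over.
rewrite ge0_integralD//; last 3 first.
- by move=> x _; rewrite -EFinM lee_fin mulr_ge0 ?sqr_ge0.
- by apply: measurable_funeM => //; exact/measurable_EFinP.
- by move=> x _; rewrite lee_fin mulr_ge0 ?sqr_ge0.
rewrite ge0_integralZl//; [|exact/measurable_EFinP|by move=> x _; rewrite lee_fin sqr_ge0].
rewrite integral_prob_cst -EFinM.
rewrite [leRHS](_ : _ = 2%:E * (6 * sigma ^+ 2)%:E + (2 * v ^+ 2)%:E)%E.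
  by apply: leeD => //; rewrite lee_pmul2l//; exact: second_moment_centered.
by rewrite -EFinM -EFinD; congr EFin; ring.
Qed.

Let int_sqr v : (N v).-integrable setT (fun x => (x ^+ 2)%:E).
Proof.
apply/integrableP; split; first exact/measurable_EFinP.
under eq_integral do rewrite /= ger0_norm ?sqr_ge0//.
exact: le_lt_trans (second_moment v) (ltry _).
Qed.

Let int_abs v : (N v).-integrable setT (fun x => `|x|%:E).
Proof.
have : (N v).-integrable setT (fun x => (1 + x ^+ 2)%:E).
  under eq_fun do rewrite EFinD.
  apply: integrableD; [by []|exact: finite_measure_integrable_cst|exact: int_sqr].
apply: le_integrable => //; first exact/measurable_EFinP.
move=> x _; rewrite !abse_EFin lee_fin normr_id [leRHS]ger0_norm ?addr_ge0 ?sqr_ge0//.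
rewrite -[x ^+ 2]ger0_norm ?sqr_ge0// normrX.
by set y := `|x|; nra.
Qed.

Let mabsE : measurable_fun setT (fun x : R => `|x|%:E).
Proof. exact/measurable_EFinP. Qed.

Let msqrE : measurable_fun setT (fun x : R => (x ^+ 2)%:E).
Proof. exact/measurable_EFinP. Qed.

Local Notation mean_abs := (mean_abs sigma).

Lemma mean_absE v : (\int[N v]_x `|x|%:E = (mean_abs v)%:E)%E.
Proof. by rewrite mean_abs.unlock fineK//; exact: (integrable_fin_num measurableT (int_abs v)). Qed.

Lemma mean_abs2 v : ((2 * mean_abs v)%:E = \int[N 0]_x (`|x + v| + `|x - v|)%:E)%E.
Proof.
rewrite EFinM -mean_absE integral_coord_law_even//.
by move=> x; rewrite normrN.
Qed.

Let mabs2 v : measurable_fun setT (fun x : R => (`|x + v| + `|x - v|)%:E).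
Proof.
apply/measurable_EFinP; apply: measurable_funD;
  by apply: measurableT_comp => //; exact: measurable_funD.
Qed.

Lemma mean_abs_le v : mean_abs v <= mean_abs 0 + `|v|.
Proof.
rewrite -(@ler_pM2l _ 2)// -lee_fin mean_abs2.
apply: (@le_trans _ _ (\int[N 0]_x (2%:E * `|x|%:E + (2 * `|v|)%:E))%E).
  apply: ge0_le_integral => //.
  - apply: emeasurable_funD => //; apply: measurable_funeM => //; exact/measurable_EFinP.
  move=> x _; rewrite -EFinM -EFinD lee_fin.
  have := ler_normD x v; have := ler_normB x v; lra.
rewrite ge0_integralD//; last by apply: measurable_funeM.
rewrite ge0_integralZl//.
by rewrite mean_absE integral_prob_cst -EFinM -EFinD lee_fin; lra.
Qed.

Lemma mean_abs_ge v : `|v| <= mean_abs v.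
Proof.
rewrite -(@ler_pM2l _ 2)// -lee_fin mean_abs2 -[leLHS](integral_prob_cst (N 0)).
apply: ge0_le_integral => //.
move=> x _; rewrite lee_fin.
have := ler_normB (x + v) (x - v).
by rewrite (_ : x + v - (x - v) = 2 * v) ?normrM ?normr_nat//; ring.
Qed.

Lemma mean_abs0_le : mean_abs 0 <= 4 * sigma.
Proof.
rewrite -(@ler_pM2l _ (2 * sigma)) ?mulr_gt0// -lee_fin EFinM -mean_absE.
rewrite -ge0_integralZl//; last by rewrite lee_fin mulr_ge0// ltW.
apply: (@le_trans _ _ (\int[N 0]_x ((sigma ^+ 2)%:E + (x ^+ 2)%:E))%E).
  apply: ge0_le_integral => //.
  - by move=> x _; rewrite -EFinM lee_fin !mulr_ge0// ltW.
  - exact: measurable_funeM.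
  - exact: emeasurable_funD.
  move=> x _; rewrite -EFinM -EFinD lee_fin.
  rewrite -[x ^+ 2]ger0_norm ?sqr_ge0// normrX -subr_ge0.
  rewrite (_ : _ - _ = (sigma - `|x|) ^+ 2) ?sqr_ge0//; ring.
rewrite ge0_integralD//; last 2 first.
- by move=> x _; rewrite lee_fin sqr_ge0.
- by move=> x _; rewrite lee_fin sqr_ge0.
rewrite integral_prob_cst.
apply: (le_trans (leeD2l _ second_moment_centered)).
rewrite -EFinD lee_fin -subr_ge0 (_ : _ - _ = sigma ^+ 2) ?sqr_ge0//; ring.
Qed.

Lemma integral_sqr_shifted_abs v k :
  (\int[N v]_x ((k + `|x|) ^+ 2)%:E =
   (k ^+ 2 + 2 * k * mean_abs v)%:E + \int[N v]_x (x ^+ 2)%:E)%E.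
Proof.
transitivity (\int[N v]_x (((k ^+ 2)%:E + (2 * k)%:E * `|x|%:E) + (x ^+ 2)%:E))%E.
  apply: eq_integral => x _; rewrite -EFinM -!EFinD; congr EFin.
  by rewrite -[in RHS](ger0_norm (sqr_ge0 x)) normrX; ring.
have i1 : (N v).-integrable setT (fun x => (k ^+ 2)%:E).
  exact: finite_measure_integrable_cst.
have i2 : (N v).-integrable setT (fun x => (2 * k)%:E * `|x|%:E)%E.
  by apply: integrableZl => //; exact: int_abs.
have i12 := integrableD measurableT i1 i2.
rewrite (integralD measurableT i12 (int_sqr v)); congr (_ + _)%E.
rewrite (integralD measurableT i1 i2) integral_prob_cst.
by rewrite (integralZl measurableT (int_abs v)) mean_absE -EFinM -EFinD.
Qed.

(** Var |X| <= E X^2 - v^2, because E|X| >= |v|. The offset [c] stands for the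
    other coordinates in the induction of [variance_l1norm]. *)
Lemma variance_abs v c :
  (\int[N v]_x ((c + (`|x| - mean_abs v)) ^+ 2)%:E <= (c ^+ 2 + 6 * sigma ^+ 2)%:E)%E.
Proof.
have -> : (\int[N v]_x ((c + (`|x| - mean_abs v)) ^+ 2)%:E =
    \int[N v]_x (((c - mean_abs v) + `|x|) ^+ 2)%:E)%E.
  by apply: eq_integral => x _; congr (_ ^+ 2)%:E; ring.
rewrite integral_sqr_shifted_abs.
apply: (le_trans (leeD2l _ (second_moment v))).
rewrite -EFinD lee_fin.
have v2 : v ^+ 2 <= mean_abs v ^+ 2.
  by rewrite -[v ^+ 2]ger0_norm ?sqr_ge0// normrX lerXn2r ?nnegrE ?mean_abs_ge//
       (le_trans _ (mean_abs_ge v)).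
by move: v2; set q := v ^+ 2; set t := sigma ^+ 2; set m := mean_abs v; nra.
Qed.

(** The standard Gaussian density at 1/2, its minimum over [-1/2, 1/2]. *)
Definition ball_rate : R := expR (- (1 / 8)) * normal_peak 1.

Lemma ball_rate_gt0 : 0 < ball_rate.
Proof. by rewrite mulr_gt0 ?expR_gt0 ?normal_peak_gt0. Qed.

Lemma coord_law_ball_ge s : 0 <= s <= 1 ->
  ((ball_rate * s)%:E <= N 0%R [set x : R | (`|x| <= s * sigma / 2)%R])%E.
Proof.
move=> /andP[s00 s1].
have r0 : 0 <= s * sigma / 2 by rewrite divr_ge0// mulr_ge0// ltW.
set r := s * sigma / 2 in r0 *.
rewrite (_ : [set x | _] = `[- r, r]%classic); last first.
  by apply/seteqP; split => x /=; rewrite in_itv/= ler_norml.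
change (is_true ((ball_rate * s)%:E <= normal_prob 0%R sigma `[(- r)%R, r]%classic)%E).
rewrite /normal_prob.
apply: (@le_trans _ _ (\int[mu]_(x in `[(- r)%R, r]) (ball_rate / sigma)%:E)%E).
  rewrite integral_cst//= lebesgue_measure_itv/=.
  case: ifP => [_|].
    rewrite -EFinB -EFinM lee_fin opprK /r.
    rewrite (_ : ball_rate / sigma * _ = ball_rate * s)//; by field.
  rewrite lte_fin -subr_gt0 opprK => /negbT; rewrite -leNgt => r2.
  rewrite mule0 lee_fin (_ : s = 0) ?mulr0//.
  apply/eqP; rewrite eq_le s00 andbT.
  have : r <= 0 by lra.
  rewrite /r => h; rewrite -(@pmulr_lle0 _ (sigma / 2)) ?divr_gt0//.
  by rewrite mulrA.
apply: ge0_le_integral => //.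
- by move=> x _; rewrite lee_fin divr_ge0 ?ltW// ball_rate_gt0.
- by apply: measurable_funTS; exact: mpdf.
move=> x; rewrite /= in_itv/= -ler_norml => xr; rewrite lee_fin normal_pdfE//.
have -> : normal_peak sigma = normal_peak 1 / sigma.
  rewrite /normal_peak expr1n mul1r -mulrnAr sqrtrM ?sqr_ge0// sqrtr_sqr gtr0_norm//.
  by rewrite invfM mulrC.
rewrite /ball_rate -mulrA mulrC ler_pM2l ?divr_gt0 ?normal_peak_gt0//.
rewrite /normal_fun ler_expR subr0 mulNr lerN2 ler_pdivrMr ?mulrn_wgt0 ?exprn_gt0//.
rewrite -[x ^+ 2]ger0_norm ?sqr_ge0// normrX.
have xs : `|x| <= sigma / 2.
  by apply: (le_trans xr); rewrite /r ler_pM2r ?invr_gt0// ler_piMl// ltW.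
rewrite [leRHS](_ : _ = (sigma / 2) ^+ 2); last by field.
by rewrite lerXn2r ?nnegrE// divr_ge0// ltW.
Qed.

(** Since |x + v| + |x - v| = 2 max (|x|, |v|), the excess of E|X| over its
    value at v = 0 is the expectation of (|v| - |x|)_+ for a centred x. Keeping
    only |x| <= s sigma / 2 gives a line in |v|; the envelope of these lines as
    [s] varies is the parabola ball_rate v^2 / (2 sigma). Lines, unlike the
    parabola, can be summed over the coordinates. *)
Lemma mean_abs_tangent v s : 0 <= s <= 1 ->
  ball_rate * s * (`|v| - s * sigma / 2) <= mean_abs v - mean_abs 0.
Proof.
move=> s01; have [s00 s1] := andP s01.
set r := s * sigma / 2.
have [vr|rv] := lerP `|v| r.
  apply: (@le_trans _ _ 0).
    by rewrite mulr_ge0_le0 ?subr_le0// mulr_ge0// ltW// ball_rate_gt0.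
  rewrite subr_ge0 -(ler_pM2l (ltr0Sn R 1)) -lee_fin (mean_abs2 v) EFinM.
  rewrite -(mean_absE 0) -ge0_integralZl//.
  apply: ge0_le_integral => //; first exact: measurable_funeM.
  move=> x _; rewrite -EFinM lee_fin.
  have := ler_normD (x + v) (x - v).
  by rewrite (_ : x + v + (x - v) = 2 * x) ?normrM ?normr_nat//; ring.
pose S := [set x : R | `|x| <= r].
have mS : measurable S.
  rewrite /S (_ : [set x | _] = `[- r, r]%classic)//.
  by apply/seteqP; split => x /=; rewrite in_itv/= ler_norml.
have mS1 : measurable_fun setT (fun x => (\1_S x)%:E : \bar R).
  by apply/measurable_EFinP; exact: measurable_indic.
have pS := coord_law_ball_ge s01.
have dv : 0 < `|v| - r by rewrite subr_gt0.
rewrite -(ler_pM2l (ltr0Sn R 1)) [leRHS]mulrBr lerBrDl -lee_fin (mean_abs2 v) EFinD EFinM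
  -(mean_absE 0).
apply: (@le_trans _ _ (2%:E * (\int[N 0]_x `|x|%:E) +
   (2 * (`|v| - r))%:E * N 0%R S)%E).
  apply: leeD2l.
  rewrite [X in (X%:E <= _)%E](_ : _ = 2 * (`|v| - r) * (ball_rate * s)); last by ring.
  by rewrite EFinM lee_pmul2l// lte_fin mulr_gt0.
rewrite -[N 0%R S](_ : (\int[N 0]_x (\1_S x)%:E)%E = _); last first.
  by rewrite integral_indic// setIT.
rewrite -!ge0_integralZl//; last by rewrite lee_fin mulr_ge0// ltW.
rewrite -ge0_integralD//; last 3 first.
- exact: measurable_funeM.
- by move=> x _; rewrite -EFinM lee_fin !mulr_ge0// ltW.
- by apply: measurable_funeM.
apply: ge0_le_integral => //.
- by move=> x _; rewrite -!EFinM -EFinD lee_fin addr_ge0 ?mulr_ge0// ltW.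
- by apply: emeasurable_funD => //; exact: measurable_funeM.
move=> x _; rewrite -!EFinM -EFinD lee_fin indicE.
have h1 : 2 * `|x| <= `|x + v| + `|x - v|.
  have := ler_normD (x + v) (x - v).
  by rewrite (_ : x + v + (x - v) = 2 * x) ?normrM ?normr_nat//; ring.
have h2 : 2 * `|v| <= `|x + v| + `|x - v|.
  have := ler_normB (x + v) (x - v).
  by rewrite (_ : x + v - (x - v) = 2 * v) ?normrM ?normr_nat//; ring.
case: (boolP (x \in S)) => /= xS; last by rewrite mulr0 addr0.
by move: xS; rewrite inE /S /= => xr; lra.
Qed.

End coordinate_moments.

(** * The l1 norm of a Gaussian vector *)

Section l1_statistic.
Context {R : realType}.
Variable sigma : R.
Hypothesis s0 : 0 < sigma.
Local Notation gauss := (@gauss R _ sigma).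
Local Notation mean_abs := (mean_abs sigma).

Definition mean_l1 d (v : d.-tuple R) : R := \sum_(i < d) mean_abs (tnth v i).

Lemma tcons_eta n (v : n.+1.-tuple R) : v = tcons (thead v, [tuple of behead v]).
Proof. by rewrite {1}(tuple_eta v). Qed.

Lemma mean_l1_tcons n b (v : n.-tuple R) :
  mean_l1 (tcons (b, v)) = mean_abs b + mean_l1 v.
Proof.
rewrite /mean_l1 big_ord_recl; congr (_ + _).
by apply: eq_bigr => i _; rewrite /tcons /= tnthS.
Qed.

Lemma mean_l1_ge0 d (v : d.-tuple R) : 0 <= mean_l1 v.
Proof. by apply: sumr_ge0 => i _; apply: le_trans (mean_abs_ge s0 _). Qed.

Lemma measurable_l1norm d : measurable_fun setT (@l1norm R d).
Proof.
apply: measurable_sum => i.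
by apply: measurableT_comp => //; exact: measurable_tnth.
Qed.

Lemma l1norm_ge0 d (x : d.-tuple R) : 0 <= l1norm x.
Proof. exact: sumr_ge0. Qed.

Lemma integral_l1norm d (v : d.-tuple R) :
  (\int[gauss v]_x (l1norm x)%:E = (mean_l1 v)%:E)%E.
Proof.
elim: d v => [|d IH] v.
  rewrite (tuple0 v) integral_dirac//; last first.
    by apply/measurable_EFinP; exact: measurable_l1norm.
  by rewrite diracT mul1e /l1norm /mean_l1 !big_ord0.
have mE k : measurable_fun setT (fun x : k.-tuple R => (l1norm x)%:E).
  by apply/measurable_EFinP; exact: measurable_l1norm.
rewrite (tcons_eta v); set b := thead v; set w := [tuple of behead v].
rewrite integral_gauss_tcons//; last by move=> x; rewrite lee_fin l1norm_ge0.
rewrite mean_l1_tcons EFinD -mean_absE//.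
rewrite -(integral_prob_cst (coord_law sigma b) (mean_l1 w)).
rewrite -ge0_integralD//; last 2 first.
- by apply/measurable_EFinP; exact: normr_measurable.
- by move=> x _; rewrite lee_fin mean_l1_ge0.
apply: eq_integral => x _.
under eq_integral do rewrite l1norm_tcons EFinD.
rewrite ge0_integralD//; [|by move=> y _; rewrite lee_fin l1norm_ge0|exact: mE].
by rewrite integral_prob_cst IH.
Qed.

(** With [c = 0] this is a variance bound; [c] makes it an induction
    hypothesis, as it collects the deviations of the coordinates already
    treated. *)
Lemma variance_l1norm d (v : d.-tuple R) c :
  (\int[gauss v]_x ((c + (l1norm x - mean_l1 v)) ^+ 2)%:E <=
   (c ^+ 2 + d%:R * (6 * sigma ^+ 2))%:E)%E.
Proof.
have mE k (u : k.-tuple R) e :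
    measurable_fun setT (fun x : k.-tuple R => ((e + (l1norm x - mean_l1 u)) ^+ 2)%:E).
  apply/measurable_EFinP; apply: measurable_funX; apply: measurable_funD => //.
  by apply: measurable_funB => //; exact: measurable_l1norm.
elim: d v c => [|d IH] v c.
  rewrite (tuple0 v) integral_dirac//; last exact: mE.
  by rewrite diracT mul1e /l1norm /mean_l1 !big_ord0 subrr addr0 mul0r addr0.
rewrite (tcons_eta v); set b := thead v; set w := [tuple of behead v].
rewrite integral_gauss_tcons//; last by move=> x; rewrite lee_fin sqr_ge0.
have mc : measurable_fun setT (fun x : R => ((c + (`|x| - mean_abs b)) ^+ 2)%:E).
  apply/measurable_EFinP; apply: measurable_funX; apply: measurable_funD => //.
  by apply: measurable_funB => //; exact: normr_measurable.
apply: (@le_trans _ _ (\int[coord_law sigma b]_x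
  (((c + (`|x| - mean_abs b)) ^+ 2)%:E + (d%:R * (6 * sigma ^+ 2))%:E))%E).
  apply: ge0_le_integral => //.
  - by move=> x _; apply: integral_ge0 => y _; rewrite lee_fin sqr_ge0.
  - apply: (measurable_integral_tcons sigma w (mE _ (tcons (b, w)) c)) => x.
    by rewrite lee_fin sqr_ge0.
  - exact: emeasurable_funD.
  move=> x _; rewrite -EFinD.
  apply: le_trans (IH w (c + (`|x| - mean_abs b))).
  rewrite le_eqVlt; apply/orP; left; apply/eqP; apply: eq_integral => y _.
  by congr (_ ^+ 2)%:E; rewrite l1norm_tcons mean_l1_tcons; ring.
rewrite ge0_integralD//; last 2 first.
- by move=> x _; rewrite lee_fin sqr_ge0.
- by move=> x _; rewrite lee_fin mulr_ge0// mulr_ge0// sqr_ge0.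
rewrite integral_prob_cst.
apply: (le_trans (leeD2r _ (variance_abs s0 b c))).
by rewrite -EFinD lee_fin -natr1; lra.
Qed.

Lemma l1norm_chebyshev d (v : d.-tuple R) (t eta : R) (A : set (d.-tuple R)) :
  measurable A -> 0 < t -> d%:R * (6 * sigma ^+ 2) <= eta * t ^+ 2 ->
  (forall x, A x -> t <= `|l1norm x - mean_l1 v|) ->
  (gauss v A <= eta%:E)%E.
Proof.
move=> mA t0 dt At.
have t2 : 0 < t ^+ 2 by rewrite exprn_gt0.
rewrite -(@lee_pmul2l _ (t ^+ 2)%:E)//.
rewrite -[gauss v A](_ : (\int[gauss v]_x (\1_A x)%:E)%E = _); last first.
  by rewrite integral_indic// setIT.
have mA1 : measurable_fun setT (fun x => (\1_A x)%:E : \bar R).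
  by apply/measurable_EFinP; exact: measurable_indic.
rewrite -ge0_integralZl//; last by rewrite lee_fin ltW.
apply: (@le_trans _ _ (\int[gauss v]_x ((0 + (l1norm x - mean_l1 v)) ^+ 2)%:E)%E).
  apply: ge0_le_integral => //.
  - by move=> x _; rewrite -EFinM lee_fin mulr_ge0// ltW.
  - exact: measurable_funeM.
  - apply/measurable_EFinP; apply: measurable_funX; apply: measurable_funD => //.
    by apply: measurable_funB => //; exact: measurable_l1norm.
  move=> x _; rewrite -EFinM lee_fin indicE add0r.
  case: (boolP (x \in A)) => xA; rewrite ?mulr0 ?sqr_ge0// mulr1.
  rewrite -[leRHS]ger0_norm ?sqr_ge0// normrX lerXn2r ?nnegrE ?(ltW t0)//.
  by apply: At; rewrite inE in xA.
apply: (le_trans (variance_l1norm _ _)).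
by rewrite -EFinM lee_fin expr0n /= add0r [leRHS]mulrC.
Qed.

(** Once the other coordinates are given, the first one is restricted to two
    values. *)
Lemma gauss_l1norm_atom d (v : d.-tuple R) r : (0 < d)%N ->
  gauss v [set x | l1norm x = r] = 0%E.
Proof.
case: d v => // d v _.
rewrite (tcons_eta v); set b := thead v; set w := [tuple of behead v].
pose A := [set x : d.+1.-tuple R | l1norm x = r].
have mA : measurable A.
  have := @measurable_l1norm d.+1 measurableT _ (measurable_set1 r).
  by rewrite setTI.
rewrite -[LHS](_ : (\int[gauss (tcons (b, w))]_x (\1_A x)%:E)%E = _); last first.
  by rewrite integral_indic// setIT.
have mA1 : measurable_fun setT (fun x => (\1_A x)%:E : \bar R).
  by apply/measurable_EFinP; exact: measurable_indic.
rewrite integral_gauss_tcons//.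
rewrite (fubini_tonelli (fun z => (\1_A (tcons z))%:E)); last 2 first.
- exact: (measurableT_comp mA1 (@measurable_tcons R d)).
- by move=> x; rewrite lee_fin.
apply: integral0_eq => y _.
have null c : coord_law sigma b [set c] = 0%E by exact: integral_set1.
pose c := r - l1norm y.
apply/eqP; rewrite eq_le; apply/andP; split; last first.
  by apply: integral_ge0 => x _; rewrite lee_fin.
have mS e : measurable_fun setT (fun x : R => (\1_[set e] x)%:E : \bar R).
  by apply/measurable_EFinP; apply: measurable_indic; exact (measurable_set1 e).
have iS e : (\int[coord_law sigma b]_x (\1_[set e] x)%:E = 0)%E.
  by rewrite integral_indic ?setIT//; exact: null.
apply: (@le_trans _ _ (\int[coord_law sigma b]_x
    ((\1_[set c] x)%:E + (\1_[set (- c)%R] x)%:E))%E); last first.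
  rewrite ge0_integralD//; try by move=> x _; rewrite lee_fin.
  by rewrite !iS adde0.
apply: ge0_le_integral => //.
- have mt : measurable_fun setT (fun x => @tcons R d (x, y)).
    by apply: (measurable_cons (f := id) (g := cst y)).
  exact: (measurableT_comp mA1 mt).
- exact: emeasurable_funD.
move=> x _; rewrite -EFinD lee_fin !indicE.
case: (boolP (_ \in A)) => xA; last by rewrite addr_ge0.
have xc : `|x| = c.
  by move: xA; rewrite inE /A /= l1norm_tcons /c => <-; ring.
have [x0|x0] := lerP 0 x.
  by rewrite mem_set ?lerDl//= -xc ger0_norm.
by rewrite [X in _ + X](_ : _ = 1) ?lerDr// mem_set//= -xc ltr0_norm// opprK.
Qed.

End l1_statistic.

(** * The plug-in test *)

Section quantile_level.
Context {R : realType} {d : nat}.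
Variables (P : probability (d.-tuple R) R) (T : d.-tuple R -> R) (alpha : R).
Hypotheses (mT : measurable_fun setT T) (alpha01 : 0 < alpha < 1).

Let mlt r : measurable [set x | r < T x].
Proof.
have := mT measurableT (measurable_itv `]r, +oo[); rewrite setTI.
by congr measurable; apply/seteqP; split => x /=; rewrite in_itv/= andbT.
Qed.

Let mle r : measurable [set x | T x <= r].
Proof.
have := mT measurableT (measurable_itv `]-oo, r]); rewrite setTI.
by congr measurable; apply/seteqP; split => x /=; rewrite in_itv/=.
Qed.

Let meq r : measurable [set x | T x = r].
Proof. by have := mT measurableT (measurable_set1 r); rewrite setTI. Qed.

Lemma quantile_exceed_lt r :
  (forall n : nat, P [set x | (r + n.+1%:R^-1 < T x)%R] <= alpha%:E)%E ->
  (P [set x | (r < T x)%R] <= alpha%:E)%E.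
Proof.
move=> H; pose F n := [set x | r + n.+1%:R^-1 < T x].
have -> : [set x | r < T x] = \bigcup_n F n.
  apply/seteqP; split => x /=; last first.
    move=> [n _]; apply: lt_trans; rewrite ltrDl invr_gt0 ltr0n//.
  rewrite -subr_gt0 => h; exists (Num.truncn (T x - r)^-1) => //.
  rewrite /F /= -ltrBrDl -[ltRHS]invrK ltf_pV2 ?posrE ?invr_gt0//.
  by apply: truncnS_gt.
have mF n : measurable (F n) by exact: mlt.
have ndF : nondecreasing_seq F.
  move=> m n mn; rewrite subsetEset => x; rewrite /F /=; apply: le_lt_trans.
  by rewrite lerD2l lef_pV2 ?posrE ?ltr0n// ler_nat ltnS.
have cF := nondecreasing_cvg_mu (mu := P) mF (bigcupT_measurable _ mF) ndF.
rewrite -(cvg_lim _ cF)//; apply: lime_le; first by apply/cvg_ex; eexists; exact: cF.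
by apply: nearW => n; exact: H.
Qed.

(** Strictly above the quantile [q] the mass is at most [alpha], by continuity
    of the measure; as there are no atoms, the boundary [T x = q] of the
    rejection region adds nothing. A lower bound on [T] excludes [q = -oo],
    for which the test would always reject. *)
Lemma quantile_level m : (forall x, m <= T x) ->
  (forall r, P [set x | T x = r] = 0%E) ->
  (P [set x | (quantile (1 - alpha) T P <= (T x)%:E)%E] <= alpha%:E)%E.
Proof.
move=> Tm atom; have [a0 a1] := andP alpha01.
have hP r : ((1 - alpha)%:E <= P [set x | (T x <= r)%R] ->
    P [set x | (r < T x)%R] <= alpha%:E)%E.
  move=> h; rewrite (_ : [set x | r < T x] = ~` [set x | T x <= r]); last first.
    by apply/seteqP; split => x /=; rewrite ltNge => /negP.
  rewrite probability_setC// leeBlDr ?fin_num_measure//.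
  by apply: le_trans (leeD2l _ h); rewrite -EFinD lee_fin; lra.
case qE: (quantile (1 - alpha) T P) => [q||].
- have le_q s : q < s -> (P [set x | (s < T x)%R] <= alpha%:E)%E.
    rewrite -lte_fin -qE => /ereal_inf_lt[_ [t /= ht <-]]; rewrite lte_fin => ts.
    apply: le_trans (hP _ ht); apply: le_measure; rewrite ?inE//.
    by move=> x /=; exact: lt_trans.
  have lt_q : (P [set x | (q < T x)%R] <= alpha%:E)%E.
    apply: quantile_exceed_lt => n; apply: le_q.
    by rewrite ltrDl invr_gt0 ltr0n.
  rewrite (_ : [set x | _] = [set x | q < T x] `|` [set x | T x = q]); last first.
    apply/seteqP; split => x /=; rewrite lee_fin le_eqVlt.
      by case/predU1P => [<-|]; [right|left].
    by case=> [->|->]; rewrite ?orbT ?eqxx.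
  apply: (le_trans (measureU2 P (mlt q) (meq q))).
  by rewrite [X in (_ + X <= _)%E](atom q) adde0.
- rewrite (_ : [set x | _] = set0) ?measure0 ?lee_fin ?ltW//.
  by apply/seteqP; split.
- have : (quantile (1 - alpha) T P < m%:E)%E by rewrite qE ltNyr.
  move=> /ereal_inf_lt[_ [t /= ht <-]]; rewrite lte_fin => tm.
  move: ht; rewrite (_ : [set x | _] = set0) ?measure0 ?lee_fin; last first.
    by apply/seteqP; split => x //=; rewrite leNgt (lt_le_trans tm).
  by move=> ?; exfalso; lra.
Qed.

End quantile_level.

Section plugin.
Context {R : realType} {d : nat}.
Variables (sigma alpha eps0 : R).
Hypotheses (s0 : 0 < sigma) (alpha01 : 0 < alpha < 1).
Local Notation gauss := (@gauss R d sigma).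
Local Notation T := (@plugin_stat R d sigma).
Local Notation psi := (@plugin_test R d sigma alpha eps0).

Lemma plugin_statE x : T x = l1norm x - d%:R * mean_abs sigma 0.
Proof.
rewrite /plugin_stat unlock integral_l1norm//=; congr (_ - _).
rewrite /mean_l1.
under eq_bigr do rewrite tnth_mktuple.
by rewrite sumr_const card_ord mulr_natl.
Qed.

Lemma measurable_plugin_stat : measurable_fun setT T.
Proof.
by apply: measurable_funB => //; exact: measurable_l1norm.
Qed.

Lemma plugin_testE :
  psi = (fun x => (ereal_sup [set quantile (1 - alpha) T (gauss v) |
              v in null_hyp eps0] <= (T x)%:E)%E).
Proof. by []. Qed.

Lemma measurable_plugin_test : measurable_fun setT psi.
Proof.
rewrite plugin_testE; case: (ereal_sup _) => [r||].
- under eq_fun do rewrite lee_fin.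
  by apply: measurable_fun_ler => //; exact: measurable_plugin_stat.
- under eq_fun do rewrite leye_eq.
  exact: measurable_cst.
- under eq_fun do rewrite leNye.
  exact: measurable_cst.
Qed.

Let mpsi c : measurable [set x | psi x = c].
Proof.
have := measurable_plugin_test measurableT (Y := [set c]); rewrite setTI; apply.
by [].
Qed.

Lemma plugin_test_valid : (0 < d)%N -> valid sigma alpha eps0 psi.
Proof.
move=> d0; split; first exact: measurable_plugin_test.
apply: ge_ereal_sup => _ [v nv <-].
have mq : measurable [set x | (quantile (1 - alpha) T (gauss v) <= (T x)%:E)%E].
  have mt : measurable_fun setT (fun x => (T x)%:E).
    by apply/measurable_EFinP; exact: measurable_plugin_stat.
  have := emeasurable_fun_c_infty measurableT mt (quantile (1 - alpha) T (gauss v)).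
  by rewrite setTI.
apply: (@le_trans _ _ (gauss v [set x | (quantile (1 - alpha) T (gauss v) <= (T x)%:E)%E])).
  apply: le_measure; rewrite ?inE//.
  move=> x /=; rewrite plugin_testE; apply: le_trans.
  by apply: ereal_sup_ubound; exists v.
apply: (quantile_level measurable_plugin_stat alpha01 (m := - (d%:R * mean_abs sigma 0))).
- by move=> x; rewrite plugin_statE lerDr l1norm_ge0.
- move=> r; rewrite (_ : [set x | _] = [set x | l1norm x = r + d%:R * mean_abs sigma 0]).
    exact: gauss_l1norm_atom.
  by apply/seteqP; split => x /=; rewrite plugin_statE => /eqP; [rewrite subr_eq => /eqP|rewrite -subr_eq => /eqP].
Qed.

(** E|X| is a 1-Lipschitz function of the mean of X, so the statistic has mean
    at most [eps0] under the null; [t] is its deviation at level [alpha]. *)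
Lemma plugin_threshold_le t : 0 < t -> d%:R * (6 * sigma ^+ 2) <= alpha * t ^+ 2 ->
  (ereal_sup [set quantile (1 - alpha) T (gauss v) | v in null_hyp eps0]
   <= (eps0 + t)%:E)%E.
Proof.
move=> t0 ht; apply: ge_ereal_sup => _ [v nv <-].
apply: ereal_inf_lbound; exists (eps0 + t) => //=.
have mT := measurable_plugin_stat.
have mgt : measurable [set x | eps0 + t < T x].
  have := mT measurableT _ (measurable_itv `]eps0 + t, +oo[); rewrite setTI.
  by congr measurable; apply/seteqP; split => x /=; rewrite in_itv/= andbT.
rewrite (_ : [set x | _] = ~` [set x | eps0 + t < T x]); last first.
  by apply/seteqP; split => x /=; rewrite leNgt => /negP.
rewrite probability_setC// EFinB leeB//.
apply: (l1norm_chebyshev s0 mgt t0 ht) => x /=; rewrite plugin_statE => h.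
have : mean_l1 sigma v <= d%:R * mean_abs sigma 0 + eps0.
  apply: (@le_trans _ _ (\sum_(i < d) (mean_abs sigma 0 + `|tnth v i|))).
    by apply: ler_sum => i _; exact: mean_abs_le.
  by rewrite big_split/= sumr_const card_ord mulr_natl lerD2l.
move=> h2; apply: le_trans (ler_norm _); lra.
Qed.

Lemma plugin_type2_le eps1 eta t u : 0 < t -> 0 < u ->
  d%:R * (6 * sigma ^+ 2) <= alpha * t ^+ 2 ->
  d%:R * (6 * sigma ^+ 2) <= eta * u ^+ 2 ->
  (forall v : d.-tuple R, eps1 <= l1norm v ->
     eps0 + t + u <= \sum_(i < d) (mean_abs sigma (tnth v i) - mean_abs sigma 0)) ->
  (type2_risk sigma eps1 psi <= eta%:E)%E.
Proof.
move=> t0 u0 ht hu gap.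
have thr := plugin_threshold_le t0 ht.
apply: ge_ereal_sup => _ [v av <-].
apply: (l1norm_chebyshev s0 (mpsi false) u0 hu) => x /=.
rewrite plugin_testE => /negbT; rewrite -ltNge => h.
have := lt_le_trans h thr; rewrite lte_fin plugin_statE => h2.
have := gap v av; rewrite sumrB sumr_const card_ord -mulr_natl => h3.
by rewrite distrC; apply: le_trans (ler_norm _); rewrite /mean_l1; lra.
Qed.

End plugin.

(** * Rates *)

Section rates.
Context {R : realType}.

Lemma ball_rate_le1 : @ball_rate R <= 1.
Proof.
have s01 : 0 <= (1 : R) <= 1 by rewrite ler01 lexx.
have := @coord_law_ball_ge R 1 ltr01 1 s01.
rewrite mulr1 => h.
have : ((@ball_rate R)%:E <= 1)%E; last by rewrite lee_fin.
apply: le_trans h _; apply: probability_le1.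
rewrite (_ : [set x | _] = `[- (1 * 1 / 2), 1 * 1 / 2]%classic)//.
by apply/seteqP; split => x /=; rewrite in_itv/= ler_norml.
Qed.

(** The same line is used for all the coordinates: it is best when the mean
    vector is spread evenly, the case where the excess is smallest. *)
Lemma excess_tangent_l1 (sigma : R) d (v : d.-tuple R) s : 0 < sigma -> 0 <= s <= 1 ->
  ball_rate * s * (l1norm v - d%:R * (s * sigma / 2)) <=
  \sum_(i < d) (mean_abs sigma (tnth v i) - mean_abs sigma 0).
Proof.
move=> s0 s01.
have -> : d%:R * (s * sigma / 2) = \sum_(i < d) (s * sigma / 2).
  by rewrite sumr_const card_ord mulr_natl.
rewrite /l1norm -sumrB mulr_sumr; apply: ler_sum => i _.
exact: (mean_abs_tangent s0 _ s01).
Qed.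

Lemma excess_linear_l1 (sigma : R) d (v : d.-tuple R) : 0 < sigma ->
  l1norm v - d%:R * (4 * sigma) <=
  \sum_(i < d) (mean_abs sigma (tnth v i) - mean_abs sigma 0).
Proof.
move=> s0.
have -> : d%:R * (4 * sigma) = \sum_(i < d) (4 * sigma).
  by rewrite sumr_const card_ord mulr_natl.
rewrite /l1norm -sumrB; apply: ler_sum => i _.
by apply: lerB; [exact: (mean_abs_ge s0)|exact: (mean_abs0_le s0)].
Qed.

(** The deterministic core of the upper bound, in units of sigma: [lam] is the
    null radius, [x] the size of the alternative, [S] the expected excess of
    the statistic, [D ^+ 2] the dimension. For [x <= D ^+ 2] the best line is
    that of slope parameter x / D^2 and gives k x^2 / (2 D^2). Beyond, the line
    [s = 1] suffices as long as [lam] is at most a small multiple of [D ^+ 2];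
    for larger [lam] the deficit of order [D ^+ 2] in the linear bound is itself
    at most of order D sqrt lam. *)
Lemma excess_gap (k C c lam D x S : R) :
  0 < k <= 1 -> 0 <= c -> C = 8 * (1 + c) / k -> 1 <= D -> 0 <= lam ->
  lam + C * (D * Num.sqrt lam) <= x -> lam + C * (D * Num.sqrt D) <= x ->
  (forall s, 0 <= s <= 1 -> k * s * (x - D ^+ 2 * (s / 2)) <= S) ->
  x - D ^+ 2 * 4 <= S ->
  lam + c * D <= S.
Proof.
move=> /andP[k0 k1] c0 CE D1 lam0 h1 h2 tang lin.
have D0 : 0 < D by apply: lt_le_trans D1.
have kC : k * C = 8 * (1 + c) by rewrite CE; field; rewrite gt_eqF.
have C0 : 0 < C by rewrite CE divr_gt0// mulr_gt0//; lra.
have C8 : 8 * (1 + c) <= C.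
  by rewrite CE ler_pdivlMr// ler_piMr//; lra.
have L0 := sqrtr_ge0 lam; have LE := sqr_sqrtr lam0.
have M0 := sqrtr_ge0 D; have ME := sqr_sqrtr (ltW D0).
set L := Num.sqrt lam in h1 L0 LE *; set M := Num.sqrt D in h2 M0 ME *.
have M1 : 1 <= M by rewrite /M -[leLHS]sqrtr1 ler_wsqrtr.
have x0 : 0 < x.
  apply: lt_le_trans h2; apply: ltr_wpDl => //.
  by rewrite !mulr_gt0//; apply: lt_le_trans M1.
have DD : D <= D ^+ 2 by rewrite expr2 ler_peMl// ltW.
have D20 : 0 < D ^+ 2 by rewrite exprn_gt0.
have [xd|dx] := lerP x (D ^+ 2).
  have s01 : 0 <= x / D ^+ 2 <= 1.
    by rewrite divr_ge0 ?(ltW x0) ?(ltW D20)//= ler_pdivrMr// mul1r.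
  apply: le_trans (tang _ s01).
  rewrite (_ : k * _ * _ = k * x ^+ 2 / (2 * D ^+ 2)); last by field; rewrite gt_eqF.
  rewrite ler_pdivlMr ?mulr_gt0//.
  have a1 : (C * (D * L)) ^+ 2 <= x ^+ 2.
    rewrite lerXn2r ?nnegrE ?(ltW x0)//; first by rewrite !mulr_ge0// ltW.
    by apply: le_trans h1; rewrite lerDr.
  have a2 : (C * (D * M)) ^+ 2 <= x ^+ 2.
    rewrite lerXn2r ?nnegrE ?(ltW x0)//; first by rewrite !mulr_ge0// ltW.
    by apply: le_trans h2; rewrite lerDr.
  have a3 : C ^+ 2 * D ^+ 2 * (lam + D) <= 2 * x ^+ 2.
    by move: a1 a2; rewrite !exprMn LE ME => a1 a2; lra.
  have kC2 : 4 * (1 + c) <= k * C ^+ 2.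
    rewrite expr2 mulrA kC.
    have : 1 <= C by lra.
    nra.
  have b0 : 0 <= D ^+ 2 * (lam + D) by rewrite mulr_ge0 ?ltW//; lra.
  have b1 : 4 * (1 + c) * (D ^+ 2 * (lam + D)) <= 2 * (k * x ^+ 2).
    apply: (@le_trans _ _ (k * C ^+ 2 * (D ^+ 2 * (lam + D)))).
      by rewrite ler_wpM2r.
    by have := ler_wpM2l (ltW k0) a3; lra.
  have b2 : (lam + c * D) * (2 * D ^+ 2) <= 2 * (1 + c) * (D ^+ 2 * (lam + D)).
    rewrite (_ : (lam + c * D) * _ = 2 * D ^+ 2 * (lam + c * D)); last by ring.
    rewrite (_ : 2 * (1 + c) * _ = 2 * D ^+ 2 * ((1 + c) * (lam + D))); last by ring.
    rewrite ler_pM2l ?mulr_gt0//.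
    have : 0 <= c * lam by rewrite mulr_ge0.
    lra.
  lra.
have [small|large] := lerP lam (k * D ^+ 2 / 4).
  have s01 : 0 <= (1 : R) <= 1 by rewrite ler01 lexx.
  apply: le_trans (tang _ s01).
  have a1 : C * D <= x.
    apply: le_trans h2; apply: (@le_trans _ _ (C * (D * M))).
      by rewrite ler_pM2l// ler_peMr// ltW.
    by rewrite lerDr.
  have a2 : 8 * (1 + c) * D <= k * x by rewrite -kC -mulrA ler_pM2l.
  have a3 : k * D ^+ 2 <= k * x by rewrite ler_pM2l// ltW.
  have a4 : 0 <= c * D by rewrite mulr_ge0// ltW.
  lra.
apply: le_trans lin.
have a1 : k * D / 2 <= L.
  have kD0 : 0 <= k * D / 2 by rewrite divr_ge0// mulr_ge0// ltW.
  rewrite -(@ler_pXn2r _ 2) ?nnegrE// LE; apply: le_trans (ltW large).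
  rewrite (_ : (_ / 2) ^+ 2 = k * (k * D ^+ 2 / 4)); last by field.
  by rewrite ler_piMl// divr_ge0// mulr_ge0 ?ltW.
have a2 : 4 * (1 + c) * D ^+ 2 <= C * (D * L).
  apply: (@le_trans _ _ (C * (D * (k * D / 2)))).
    rewrite le_eqVlt; apply/orP; left; apply/eqP.
    have -> : C * (D * (k * D / 2)) = k * C * (D ^+ 2 / 2) by field.
    by rewrite kC; field.
  by rewrite ler_pM2l// ler_pM2l.
have a3 : c * D <= c * D ^+ 2 by rewrite ler_wpM2l.
have a4 : 0 <= c * D ^+ 2 by rewrite mulr_ge0// ltW.
lra.
Qed.

Lemma plugin_type2_rate (alpha eta : R) : 0 < alpha < 1 -> 0 < eta ->
  exists2 C : R, 0 < C & forall (d : nat) (sigma eps0 eps1 : R),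
    (0 < d)%N -> 0 < sigma -> 0 <= eps0 ->
    C * (sigma * (Num.sqrt d%:R * Num.sqrt (eps0 / sigma))) <= eps1 - eps0 ->
    C * (sigma * (Num.sqrt d%:R * Num.sqrt (Num.sqrt d%:R))) <= eps1 - eps0 ->
    (type2_risk sigma eps1 (@plugin_test R d sigma alpha eps0) <= eta%:E)%E.
Proof.
move=> alpha01 eta0; have [a0 a1] := andP alpha01.
pose c1 := Num.sqrt (6 / alpha); pose c2 := Num.sqrt (6 / eta).
have c10 : 0 < c1 by rewrite sqrtr_gt0 divr_gt0.
have c20 : 0 < c2 by rewrite sqrtr_gt0 divr_gt0.
pose k := @ball_rate R.
have k0 : 0 < k by exact: ball_rate_gt0.
exists (8 * (1 + (c1 + c2)) / k).
  by rewrite divr_gt0// mulr_gt0//; lra.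
move=> d sigma eps0 eps1 d0 s0 e0 h1 h2.
set D : R := Num.sqrt d%:R in h1 h2.
have dR : 1 <= d%:R :> R by rewrite ler1n.
have D1 : 1 <= D by rewrite /D -[leLHS]sqrtr1 ler_wsqrtr.
have D0 : 0 < D by apply: lt_le_trans D1.
have DE : D ^+ 2 = d%:R by rewrite sqr_sqrtr// ler0n.
have c1E : alpha * c1 ^+ 2 = 6 by rewrite sqr_sqrtr ?divr_ge0 ?ltW//; field; rewrite gt_eqF.
have c2E : eta * c2 ^+ 2 = 6 by rewrite sqr_sqrtr ?divr_ge0 ?ltW//; field; rewrite gt_eqF.
apply: (plugin_type2_le s0 (t := c1 * D * sigma) (u := c2 * D * sigma)).
- by rewrite !mulr_gt0.
- by rewrite !mulr_gt0.
- rewrite (_ : alpha * _ = alpha * c1 ^+ 2 * D ^+ 2 * sigma ^+ 2); last by ring.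
  by rewrite c1E DE; lra.
- rewrite (_ : eta * _ = eta * c2 ^+ 2 * D ^+ 2 * sigma ^+ 2); last by ring.
  by rewrite c2E DE; lra.
move=> v hv.
set S := \sum_(i < d) _.
have lamE : eps0 / sigma * sigma = eps0 by rewrite divfK// gt_eqF.
set lam := eps0 / sigma in h1 lamE *.
have lam0 : 0 <= lam by rewrite divr_ge0// ltW.
have xE : l1norm v / sigma * sigma = l1norm v by rewrite divfK// gt_eqF.
set x := l1norm v / sigma in xE.
suff : lam + (c1 + c2) * D <= S / sigma.
  by rewrite ler_pdivlMr// mulrDl lamE; lra.
apply: (@excess_gap k _ (c1 + c2) lam D x (S / sigma)) => //.
- by rewrite k0 ball_rate_le1.
- by rewrite addr_ge0 ?ltW.
- rewrite -(@ler_pM2r _ sigma)// mulrDl lamE xE; apply: le_trans hv.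
  by rewrite -mulrA [_ * sigma]mulrC; lra.
- rewrite -(@ler_pM2r _ sigma)// mulrDl lamE xE; apply: le_trans hv.
  by rewrite -mulrA [_ * sigma]mulrC; lra.
- move=> s s01; rewrite ler_pdivlMr//.
  apply: le_trans (excess_tangent_l1 v s0 s01).
  by rewrite -xE DE le_eqVlt; apply/orP; left; apply/eqP; rewrite /k; ring.
- rewrite ler_pdivlMr//; apply: le_trans (excess_linear_l1 v s0).
  by rewrite -xE DE le_eqVlt; apply/orP; left; apply/eqP; ring.
Qed.

(** The divergence n t^4 stays bounded for t of order d^(-1/4). *)
Lemma minimax_risk_dense_rate (alpha beta : R) : 0 < 1 - alpha - beta < 1 ->
  forall (d : nat) (sigma eps0 eps1 : R), (1 < d)%N -> 0 < sigma -> 0 <= eps0 ->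
    eps1 <= eps0 + (1 - alpha - beta) / 8 *
      (sigma * (Num.sqrt d%:R * Num.sqrt (Num.sqrt d%:R))) ->
    (beta%:E <= @minimax_risk R d sigma alpha eps0 eps1)%E.
Proof.
move=> g01 [//|n] sigma eps0 eps1 d1 s0 e0 he.
have [g0 g1] := andP g01; set g := 1 - alpha - beta in g01 g0 g1 he *.
set d : R := n.+1%:R in he; set D := Num.sqrt d in he; set M := Num.sqrt D in he.
have dR : 1 <= d by rewrite ler1n.
have D1 : 1 <= D by rewrite /D -[leLHS]sqrtr1 ler_wsqrtr.
have M1 : 1 <= M by rewrite /M -[leLHS]sqrtr1 ler_wsqrtr.
have DE : D ^+ 2 = d by rewrite sqr_sqrtr// (le_trans _ dR).
have ME : M ^+ 2 = D by rewrite sqr_sqrtr// (le_trans _ D1).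
have M0 : 0 < M by apply: lt_le_trans M1.
have nd : n%:R <= d by rewrite ler_nat.
have dn : d / 2 <= n%:R.
  have n1 : 1 <= n%:R :> R by rewrite ler1n.
  have dE : d = n%:R + 1 by rewrite natr1.
  lra.
have d0 : 0 < d by apply: lt_le_trans dR.
have t2 : (g / 4 / M) ^+ 2 = g ^+ 2 / 16 / D.
  by rewrite -ME; field; rewrite gt_eqF.
have g2 : g ^+ 2 <= 1 by rewrite expr_le1// ltW.
have D0 : 0 < D by apply: lt_le_trans D1.
apply: (@minimax_risk_ge_dense R alpha beta sigma eps0 eps1 (g / 4 / M) n) => //.
- by rewrite !divr_ge0// ltW.
- rewrite t2 ler_pdivrMr//; lra.
- rewrite (_ : (g / 4 / M) ^+ 4 = ((g / 4 / M) ^+ 2) ^+ 2); last by rewrite -exprM.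
  rewrite t2; pose z := g ^+ 2 / 16.
  have z0 : 0 <= z by rewrite divr_ge0// sqr_ge0.
  rewrite -/z (_ : (z / D) ^+ 2 = z ^+ 2 / d); last first.
    by rewrite -DE; field; rewrite gt_eqF.
  apply: (@le_trans _ _ (2 * z ^+ 2)).
    rewrite mulrCA ler_pM2l// mulrCA ler_piMr ?sqr_ge0//.
    by rewrite ler_pdivrMr// mul1r.
  by have z1 : z <= 1 / 2; [rewrite /z; lra|nra].
- apply: (le_trans he); rewrite lerD2l.
  apply: (@le_trans _ _ (d / 2 * (sigma * (g / 4 / M)))); last first.
    by rewrite ler_wpM2r// mulr_ge0 ?divr_ge0 ?ltW.
  rewrite le_eqVlt; apply/orP; left; apply/eqP.
  by rewrite -DE -ME; field; rewrite gt_eqF.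
Qed.

(** N of order log d makes the divergence 4^(-2N) per coordinate negligible
    against 1 / d. The null radius n sigma N^2 u^2 is at most a small multiple of
    [eps0] if [u] is of order sqrt (lambda / d) / N^2; the assumption
    lambda <= K d makes u N^2 small, as is needed for the construction and for
    the null radius to be at most half the separation n sigma u. *)
Lemma minimax_risk_sparse_rate (alpha beta K : R) :
  0 < 1 - alpha - beta < 1 -> 0 < K ->
  exists2 c : R, 0 < c & exists d0 : nat, forall (d : nat) (sigma eps0 eps1 : R),
    (d0 <= d)%N -> 0 < sigma -> 0 < eps0 -> eps0 / sigma <= K * d%:R ->
    eps1 <= eps0 + c * (sigma * (Num.sqrt d%:R * Num.sqrt (eps0 / sigma)))
                     / ln d%:R ^+ 2 ->
    (beta%:E <= @minimax_risk R d sigma alpha eps0 eps1)%E.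
Proof.
move=> g01 K0; have [g0 g1] := andP g01.
set g := 1 - alpha - beta in g01 g0 g1 *.
pose k1 := Num.sqrt K; pose e := g / (24 * (1 + k1)).
have k10 : 0 < k1 by rewrite sqrtr_gt0.
have e0 : 0 < e by rewrite divr_gt0// mulr_gt0//; lra.
have eE : e * (24 * (1 + k1)) = g by rewrite /e divfK// gt_eqF// mulr_gt0//; lra.
exists (e / 36); first by rewrite divr_gt0.
exists (maxn 4 (maxn (Num.truncn (16 / g ^+ 2)).+1 (Num.truncn (expR (1 : R))).+1)).
move=> d sigma eps0 eps1; rewrite !geq_max => /and3P[d4 dg de] s0 ep0 lamK.
have dge : 16 / g ^+ 2 <= d%:R.
  by apply: ltW; apply: lt_le_trans (truncnS_gt _) _; rewrite ler_nat.
have dexp : expR 1 <= d%:R :> R.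
  by apply: ltW; apply: lt_le_trans (truncnS_gt _) _; rewrite ler_nat.
case: d d4 {dg de} dge dexp lamK => // n d4 dge dexp lamK.
set d : R := n.+1%:R in dge dexp lamK *.
have dR : 4 <= d by rewrite /d (ler_nat R 4).
have d0 : 0 < d by apply: lt_le_trans dR.
have ln1 : 1 <= ln d by rewrite -ler_expR lnK ?posrE.
pose N := (trunc_log 2 n.+1).+1.
have [N1 N2] : (2 ^ N.-1 <= n.+1)%N /\ (n.+1 < 2 ^ N)%N.
  by have /andP[] := @trunc_log_bounds 2 n.+1 isT isT.
have NR : 0 < N%:R :> R by rewrite ltr0n.
have NR1 : 1 <= N%:R :> R by rewrite ler1n.
have Nln : N%:R <= 3 * ln d.
  have ln2 : 1 / 2 <= ln 2 :> R.
    rewrite -ler_expR lnK ?posrE//.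
    apply: (@le_trans _ _ (1 - 1 / 2)^-1); first by apply: expR_le_invr; lra.
    by rewrite le_eqVlt; apply/orP; left; apply/eqP; field.
  have h1 : N.-1%:R * ln 2 <= ln d.
    rewrite mulr_natl -lnXn// ler_ln ?posrE ?exprn_gt0//.
    by rewrite -natrX ler_nat.
  have NE : N%:R = N.-1%:R + 1 :> R by rewrite natr1.
  have h2 : N.-1%:R * (1 / 2) <= N.-1%:R * ln 2 :> R by rewrite ler_wpM2l.
  by rewrite NE; lra.
set lam := eps0 / sigma in lamK *.
have lamE : lam * sigma = eps0 by rewrite divfK// gt_eqF.
have lam0 : 0 < lam by rewrite divr_gt0.
set D := Num.sqrt d; set L := Num.sqrt lam.
have D0 : 0 < D by rewrite sqrtr_gt0.
have L0 : 0 < L by rewrite sqrtr_gt0.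
have DE : D ^+ 2 = d by rewrite sqr_sqrtr// ltW.
have LE : L ^+ 2 = lam by rewrite sqr_sqrtr// ltW.
have LD : L <= k1 * D.
  by rewrite /k1 /D -sqrtrM ?(ltW K0)// ler_wsqrtr.
pose u := e * L / (D * N%:R ^+ 2).
have u0 : 0 < u by rewrite /u divr_gt0// mulr_gt0// exprn_gt0.
have uN : u * N%:R ^+ 2 <= g / 24.
  rewrite /u (_ : _ * _ = e * (L / D)); last by field; rewrite !gt_eqF.
  rewrite -eE (_ : _ / 24 = e * (1 + k1)); last by field.
  by rewrite ler_pM2l// ler_pdivrMr// mulrDl; lra.
have nR : n%:R <= d by rewrite ler_nat.
have dn : d / 2 <= n%:R.
  have dE : d = n%:R + 1 by rewrite natr1.
  lra.
have n0 : (0 < n)%N by rewrite -ltnS (leq_trans _ d4).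
have nR0 : 0 < n%:R :> R by rewrite ltr0n.
have uE : N%:R ^+ 2 * u ^+ 2 = e ^+ 2 * lam / (d * N%:R ^+ 2).
  by rewrite /u -DE -LE; field; rewrite !gt_eqF.
have e2 : 12 * e ^+ 2 <= g.
  have : e <= g / 24.
    by rewrite -eE ler_pdivlMr//; nra.
  nra.
move=> he.
apply: (@minimax_risk_ge_sparse R alpha beta sigma eps0 eps1 u n N) => //.
- rewrite -div1r ler_pdivlMr ?mulr_gt0 ?exprn_gt0//.
  by rewrite mulrCA; lra.
- rewrite -/g.
  apply: (@le_trans _ _ (d * d^-1 ^+ 2)).
    apply: ler_pM => //.
    rewrite (_ : 1 / 4 = (2^-1) ^+ 2); last by field.
    rewrite -exprM mulnA mulnC exprM exprVn.
    have p2 : (2 ^+ N : R)^-1 <= d^-1.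
      by rewrite lef_pV2 ?posrE ?exprn_gt0// -natrX ler_nat ltnW.
    have p20 : 0 <= (2 ^+ N : R)^-1 by rewrite invr_ge0 exprn_ge0.
    apply: (@le_trans _ _ (d^-1 ^+ 4)); first by rewrite lerXn2r ?nnegrE ?(le_trans p20 p2).
    rewrite (_ : 4 = 2 + 2)%N// exprD ler_piMr ?exprn_ge0 ?invr_ge0 ?(ltW d0)//.
    by rewrite expr_le1 ?invr_ge0 ?(ltW d0)// invf_le1//; lra.
  rewrite expr2 mulrA divff ?gt_eqF// mul1r.
  move: dge; rewrite ler_pdivrMr ?exprn_gt0// => dge.
  by rewrite -(@ler_pM2l _ d)// divff ?gt_eqF//; lra.
- rewrite -/g ler_pdivrMr// -lamE.
  rewrite (_ : n%:R * _ = 12 * (N%:R ^+ 2 * u ^+ 2) * n%:R * sigma); last by ring.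
  rewrite (_ : lam * sigma * g = lam * g * sigma); last by ring.
  rewrite ler_pM2r// uE.
  have q1 : n%:R / (d * N%:R ^+ 2) <= 1.
    rewrite ler_pdivrMr ?mulr_gt0 ?exprn_gt0// mul1r.
    apply: (le_trans nR); rewrite ler_peMr ?(ltW d0)//.
    by rewrite exprn_ege1.
  rewrite (_ : _ * n%:R = 12 * e ^+ 2 * lam * (n%:R / (d * N%:R ^+ 2))); last first.
    by field; rewrite !gt_eqF.
  apply: (@le_trans _ _ (12 * e ^+ 2 * lam)).
    by rewrite ler_piMr// mulr_ge0 ?(ltW lam0)// mulr_ge0// sqr_ge0.
  by rewrite [leRHS]mulrC ler_pM2r.
- apply: (le_trans he); rewrite -addrA lerD2l -/g.
  rewrite (_ : n%:R * (sigma * (12 * N%:R ^+ 2 * u ^+ 2)) / g =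
    n%:R * (sigma * u) * (12 / g * (u * N%:R ^+ 2))); last by field; rewrite gt_eqF.
  have h1 : 12 / g * (u * N%:R ^+ 2) <= 1 / 2.
    apply: (@le_trans _ _ (12 / g * (g / 24))).
      by rewrite ler_pM2l// divr_gt0.
    by rewrite le_eqVlt; apply/orP; left; apply/eqP; field; rewrite gt_eqF.
  apply: (@le_trans _ _ (n%:R * (sigma * u) * (1 / 2))); last first.
    have X0 : 0 <= n%:R * (sigma * u) by apply: mulr_ge0 => //; apply: mulr_ge0; exact: ltW.
    by have h2 := ler_wpM2l X0 h1; lra.
  apply: (@le_trans _ _ (d / 2 * (sigma * u) * (1 / 2))); last first.
    by rewrite ler_pM2r// ler_pM2r// mulr_gt0.
  rewrite ler_pdivrMr ?exprn_gt0 ?(lt_le_trans _ ln1)//.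
  rewrite (_ : _ * ln d ^+ 2 = e / 4 * (sigma * (D * L)) * (ln d ^+ 2 / N%:R ^+ 2)); last first.
    by rewrite /u -DE; field; rewrite !gt_eqF.
  rewrite (_ : e / 36 * _ = e / 4 * (sigma * (D * L)) * (1 / 9)); last by field.
  have p0 : 0 < e / 4 * (sigma * (D * L)).
    by apply: mulr_gt0; [exact: divr_gt0|do 2 apply: mulr_gt0 => //].
  rewrite (ler_pM2l p0) ler_pdivlMr ?exprn_gt0//.
  have : N%:R ^+ 2 <= (3 * ln d) ^+ 2 by rewrite lerXn2r ?nnegrE ?(ltW NR) ?(le_trans (ltW NR) Nln).
  by rewrite exprMn; lra.
Qed.

End rates.

(** With lambda <= K1 sqrt d one has sqrt (d lambda) = O(d^(3/4)), so the dense
    rate dominates; with lambda >= k2 sqrt d the converse holds, and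
    sqrt (d lambda) is of order d when lambda is. *)
Lemma regime_rate_bounds (R : realType) (K1 k2 K2 k3 K3 : R) :
  0 < K1 -> 0 < k2 -> 0 < K2 -> 0 < k3 -> 0 < K3 ->
  exists A B : R, [/\ 0 < A, 0 < B & forall (d : nat) (sigma eps0 r : R),
    (0 < d)%N -> 0 < sigma -> 0 <= eps0 ->
    regime_rate K1 k2 K2 k3 K3 d sigma (eps0 / sigma) r ->
    let dense := sigma * (Num.sqrt d%:R * Num.sqrt (Num.sqrt d%:R)) in
    let sparse := sigma * (Num.sqrt d%:R * Num.sqrt (eps0 / sigma)) in
    [/\ r <= A * dense \/
          [/\ 0 < eps0, eps0 / sigma <= (K2 + K3) * d%:R & r <= A * sparse],
        sparse <= B * r & dense <= B * r]].
Proof.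
move=> K10 k20 K20 k30 K30.
have q1 : 0 < Num.sqrt K1 by rewrite sqrtr_gt0.
have q2 : 0 < Num.sqrt k2 by rewrite sqrtr_gt0.
have q3 : 0 < Num.sqrt k3 by rewrite sqrtr_gt0.
have Q3 : 0 < Num.sqrt K3 by rewrite sqrtr_gt0.
have q2' : 0 < (Num.sqrt k2)^-1 by rewrite invr_gt0.
have q3' : 0 < (Num.sqrt k3)^-1 by rewrite invr_gt0.
exists (1 + (Num.sqrt k3)^-1), (1 + Num.sqrt K1 + (Num.sqrt k2)^-1 + Num.sqrt K3).
split; [by lra|by lra|] => d sigma eps0 r d0 s0 e0.
set lam := eps0 / sigma; set D : R := Num.sqrt d%:R.
set M := Num.sqrt D; set L := Num.sqrt lam.
have dR : 1 <= d%:R :> R by rewrite ler1n.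
have dR0 : 0 < d%:R :> R by rewrite ltr0n.
have D0 : 0 < D by rewrite sqrtr_gt0.
have M0 : 0 < M by rewrite sqrtr_gt0.
have lam0 : 0 <= lam by rewrite divr_ge0// ltW.
have L0 : 0 <= L by rewrite sqrtr_ge0.
have DE : D * D = d%:R by rewrite -expr2 sqr_sqrtr// ltW.
have M1 : M <= D.
  have D1 : 1 <= D by rewrite /D -[leLHS]sqrtr1 ler_wsqrtr.
  rewrite -[leRHS]ger0_norm ?(ltW D0)// -sqrtr_sqr ler_wsqrtr//.
  by rewrite expr2 ler_peMl// ltW.
have epos : 0 < lam -> 0 < eps0.
  by rewrite /lam => h; rewrite -(@pmulr_lgt0 _ (sigma^-1)) ?invr_gt0.
have sD : 0 < sigma * D by rewrite mulr_gt0.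
have bound A x y z : 0 <= A -> x <= z * y -> z <= A -> 0 <= y ->
    sigma * (D * x) <= A * (sigma * (D * y)).
  move=> A0 xy zA y0; rewrite mulrA [A * _](_ : _ = sigma * D * (A * y)); last by ring.
  by rewrite ler_pM2l//; apply: (le_trans xy); exact: ler_wpM2r.
case=> [[/andP[_ h] ->]|[/andP[h1 h2] ->]|[/andP[h1 h2] ->]] /=.
- have -> : sigma * d%:R `^ (3 / 4) = sigma * (D * M).
    rewrite /M /D -!powR12_sqrt ?powR_ge0 ?ler0n// -powRrM -powRD; last first.
      by rewrite gt_eqF ?implybT// ; apply/implyP => _; rewrite gt_eqF.
    by congr (_ * _ `^ _); field.
  split; first by left; apply: (bound _ _ _ 1); rewrite ?mul1r//; solve [lra|exact: ltW].
    apply: (bound _ _ _ (Num.sqrt K1)); [lra| |lra|exact: ltW].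
    by rewrite /M /L -sqrtrM ?(ltW K10)// ler_wsqrtr.
  by apply: (bound _ _ _ 1); rewrite ?mul1r//; solve [lra|exact: ltW].
- have lamp : 0 < lam by apply: lt_le_trans h1; rewrite mulr_gt0.
  split.
  + right; split; [exact: epos|by rewrite mulrDl; apply: (le_trans h2); rewrite lerDl mulr_ge0// ltW|].
    by apply: (bound _ _ _ 1); rewrite ?mul1r//; solve [lra|exact: ltW].
  + by apply: (bound _ _ _ 1); rewrite ?mul1r//; solve [lra|exact: ltW].
  + apply: (bound _ _ _ (Num.sqrt k2)^-1); [lra| |lra|by []].
    by rewrite mulrC ler_pdivlMr// mulrC -sqrtrM ?(ltW k20)// ler_wsqrtr.
- have lamp : 0 < lam by apply: lt_le_trans h1; rewrite mulr_gt0.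
  rewrite -DE; split.
  + right; split; [exact: epos|by rewrite mulrDl DE; apply: (le_trans h2); rewrite lerDr mulr_ge0// ltW|].
    apply: (bound _ _ _ (Num.sqrt k3)^-1); [lra| |lra|by []].
    by rewrite mulrC ler_pdivlMr// mulrC -sqrtrM ?(ltW k30)// ler_wsqrtr.
  + apply: (bound _ _ _ (Num.sqrt K3)); [lra| |lra|exact: ltW].
    by rewrite /D -sqrtrM ?(ltW K30)// ler_wsqrtr.
  + by apply: (bound _ _ _ 1); rewrite ?mul1r//; solve [lra|exact: ltW].
Qed.

Theorem theorem3p1 (R : realType) (alpha beta : R)
    (alpha01 : 0 < alpha < 1) (beta01 : 0 < beta < 1 - alpha) :
  (forall (d : nat) (sigma eps0 : R), (0 < d)%N -> 0 < sigma <= 1 ->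
     0 <= eps0 -> valid sigma alpha eps0 (@plugin_test R d sigma alpha eps0)) /\
  (forall K1 k2 K2 k3 K3 : R,
     0 < K1 -> 0 < k2 -> 0 < K2 -> 0 < k3 -> 0 < K3 ->
   exists c C a : R, [/\ 0 < c, 0 < C, 0 < a &
   exists d0 : nat, forall (d : nat) (sigma eps0 r : R),
     (0 < d)%N -> (d0 <= d)%N -> 0 < sigma <= 1 -> 0 <= eps0 ->
     regime_rate K1 k2 K2 k3 K3 d sigma (eps0 / sigma) r ->
     [/\ ((c * ln d%:R `^ (- a) * r)%:E <=
            critical_separation d sigma alpha beta eps0)%E,
         (critical_separation d sigma alpha beta eps0 <=
            (C * ln d%:R `^ a * r)%:E)%E
       & forall eps1 : R, C * ln d%:R `^ a * r <= eps1 - eps0 ->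
           powerful sigma beta eps1 (@plugin_test R d sigma alpha eps0)]]).
Proof.
split=> [d sigma eps0 d0 /andP[s0 _] _|K1 k2 K2 k3 K3 K10 k20 K20 k30 K30].
  exact: plugin_test_valid.
have [b0 b1] := andP beta01; have [a0 a1] := andP alpha01.
have g01 : 0 < 1 - alpha - beta < 1 by apply/andP; split; lra.
have [g0 g1] := andP g01.
(* The error [beta / 2] leaves room for the strict inequality in the definition
   of the critical separation. *)
have [C0 C00 upper] := plugin_type2_rate alpha01 (divr_gt0 b0 (ltr0Sn R 1)).
have K230 : 0 < K2 + K3 by rewrite addr_gt0.
have [c1 c10 [d1 sparse_lb]] := minimax_risk_sparse_rate g01 K230.
have dense_lb := minimax_risk_dense_rate g01.
pose c2 := (1 - alpha - beta) / 8.
have c20 : 0 < c2 by rewrite divr_gt0.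
have [A [B [A0 B0 rates]]] := regime_rate_bounds K10 k20 K20 k30 K30.
pose c := Num.min c1 c2 / A.
have c0 : 0 < c by rewrite divr_gt0// lt_min c10.
(* The exponent 2 comes from [minimax_risk_sparse_rate] alone. *)
exists c, (C0 * B), 2; split=> //; first by rewrite mulr_gt0.
(* [expR 1 <= d] ensures that [ln d] is at least 1. *)
exists (maxn (maxn 2 d1) (Num.truncn (expR (1 : R))).+1) => d sigma eps0 r d0.
rewrite !geq_max => /andP[/andP[d2 dd1] de] /andP[s0 _] e0 reg.
have dexp : expR 1 <= d%:R :> R.
  by apply: ltW; apply: lt_le_trans (truncnS_gt _) _; rewrite ler_nat.
have dR : 0 < d%:R :> R by rewrite ltr0n.
have ln1 : 1 <= ln (d%:R : R) by rewrite -ler_expR lnK ?posrE.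
have [low up1 up2] := rates _ _ _ _ d0 s0 e0 reg.
set dense := sigma * _ in up2; set sparse := sigma * _ in up1.
rewrite -/dense -/sparse in low.
have ln0 : 0 <= ln (d%:R : R) by rewrite (le_trans _ ln1).
rewrite powRN !powR_mulrn//.
have ln2 : 1 <= ln (d%:R : R) ^+ 2 by rewrite exprn_ege1.
set ell := ln d%:R ^+ 2 in ln2 *.
have ell0 : 0 < ell by apply: lt_le_trans ln2.
have r0 : 0 <= r.
  have : 0 <= B * r by apply: le_trans up2; rewrite !mulr_ge0 ?sqrtr_ge0// ltW.
  by rewrite pmulr_rge0.
have test eps1 : C0 * B * ell * r <= eps1 - eps0 ->
    (type2_risk sigma eps1 (@plugin_test R d sigma alpha eps0) <= (beta / 2)%:E)%E.
  move=> h; have hr : C0 * (B * r) <= eps1 - eps0.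
    apply: le_trans h; rewrite (_ : C0 * B * ell * r = C0 * (B * r) * ell); last by ring.
    by rewrite ler_peMr// !mulr_ge0// ltW.
  apply: upper => //; apply: le_trans hr; rewrite ler_pM2l//.
split.
- rewrite /critical_separation leeBrDr//.
  apply: le_ereal_inf_tmp => _ [eps1 [e01 risk] <-].
  rewrite -EFinD lee_fin leNgt; apply/negP => he.
  have : (beta%:E <= minimax_risk d sigma alpha eps0 eps1)%E.
    have cA : c * A = Num.min c1 c2 by rewrite /c divfK// gt_eqF.
    case: low => [hd|[ep hl hs]].
      apply: dense_lb => //; apply: (le_trans (ltW he)).
      rewrite addrC lerD2l.
      apply: (@le_trans _ _ (c * r)).
        by rewrite ler_wpM2r// ler_piMr ?(ltW c0)// invf_le1.
      apply: (@le_trans _ _ (c * (A * dense))); first by rewrite ler_pM2l.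
      rewrite (mulrA c) cA -/dense -/c2 ler_wpM2r ?ge_min ?lexx ?orbT//.
      by rewrite !mulr_ge0 ?sqrtr_ge0// ltW.
    apply: sparse_lb => //; apply: (le_trans (ltW he)).
    rewrite addrC lerD2l mulrAC ler_pM2r ?invr_gt0//.
    apply: (@le_trans _ _ (c * (A * sparse))); first by rewrite ler_pM2l.
    rewrite (mulrA c) cA -/sparse ler_wpM2r ?ge_min ?lexx//.
    by rewrite !mulr_ge0 ?sqrtr_ge0// ltW.
  by move=> /(lt_le_trans risk); rewrite ltxx.
- rewrite /critical_separation leeBlDr// -EFinD.
  apply: ereal_inf_lbound; eexists; last by [].
  have h0 : 0 <= C0 * B * ell * r.
    by rewrite mulr_ge0// mulr_ge0 ?(ltW ell0)// ltW// mulr_gt0.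
  split; first by rewrite lerDr.
  apply: (@le_lt_trans _ _ (beta / 2)%:E); last by rewrite lte_fin; lra.
  apply: ge_ereal_inf; exists (type2_risk sigma (C0 * B * ell * r + eps0)
      (@plugin_test R d sigma alpha eps0)).
    by exists (@plugin_test R d sigma alpha eps0) => //; exact: plugin_test_valid.
  by apply: test; rewrite addrK.
- move=> eps1 h; split; first exact: measurable_plugin_test.
  by apply: le_trans (test _ h) _; rewrite lee_fin; lra.
Qed.
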